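(* Let $f:\{0,1\}^{\mathbb N}\to\mathbb R$ be a Lipschitz function for which there exist negative numbers $b,d,\{a_n\}_{n\ge2},\{c_n\}_{n\ge2}$ such that, for $n\ge2$, $$f|_{[01]}=b,\quad f|_{[10]}=d,\quad f(0^\infty)=f(1^\infty)=0,\quad f|_{[0^n1]}=a_n,\quad f|_{[1^n0]}=c_n,$$ and for $\beta>0$ let $\mu_\beta$ be the equilibrium measure of $\beta f$. Suppose $\sum_{j\ge2}a_j<b+d+\sum_{j\ge2}c_j$. Then $(\mu_\beta)_{\beta>0}$ satisfies a large deviation principle with deviation function $I$ defined by $$I(0^\infty)=b+d+\sum_{j\ge2}c_j-\sum_{j\ge2}a_j,\qquad I(1^\infty)=0,$$ and for any $x\in\{0,1\}^{\mathbb N}$, $$I(x)=\begin{cases}R_+^n(x)+I(0^\infty)&\text{if }x=(x_1\dots x_n0^\infty),\\ R_+^n(x)&\text{if }x=(x_1\dots x_n1^\infty),\\ +\infty&\text{else,}\end{cases}$$ where $R_+=-f-U+U\circ\sigma$ and $U:\{0,1\}^{\mathbb N}\to\mathbb R$ satisfies $$U(0^\infty)=0,\qquad U|_{[0^q1]}=\max\left\{b+d+\sum_{j=2}^\infty c_j,\ \sum_{j=1}^\infty a_{q+j}\right\},\quad q\ge1,$$ $$U(1^\infty)=b,\qquad U|_{[1^q0]}=b+\sum_{j=1}^\infty c_{q+j},\quad q\ge1.$$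
   Context: $X=\{0,1\}^{\mathbb N}$, $\mathbb N=\{1,2,3,\dots\}$, with the metric $d_\theta(x,y)=\theta^{\min\{i:\,x_i\ne y_i\}}$ for $x\neq y$, $\theta\in(0,1)$ fixed; $\sigma$ is the shift map. A cylinder is a set $[x_1\dots x_n]$ of all points of $X$ starting with the word $x_1\dots x_n$. $0^n$ (resp. $1^n$) is the word of $n$ zeros (resp. ones), $0^\infty=(000\dots)$, $1^\infty=(111\dots)$, and $[0^n1]$, $[1^n0]$ are the corresponding cylinders. $(x_1\dots x_n y)$ denotes concatenation of the word $x_1\dots x_n$ with $y\in X$. The sums $\sum_{j\ge 2}a_j$ and $\sum_{j\ge 2}c_j$ are finite because $f$ is Lipschitz with $f(0^\infty)=f(1^\infty)=0$. The equilibrium measure $\mu_\beta$ of $\beta f$ is the unique $\sigma$-invariant Borel probability attaining $P(\beta f)=\sup_\mu\left(\int\beta f\,d\mu+h(\mu)\right)$, the supremum over $\sigma$-invariant Borel probabilities $\mu$ on $X$, where $h(\mu)$ is the Kolmogorov–Sinai entropy. Large deviation principle: $(\mu_\beta)_{\beta>0}$ satisfies a large deviation principle with deviation function $I$ if $I:X\to[0,+\infty]$ is lower semi-continuous and, for any cylinder $k\subset X$, $\lim_{\beta\to+\infty}\frac1\beta\log(\mu_\beta(k))=-\inf_{x\in k}I(x)$. $R_+^n(x):=\sum_{j=0}^{n-1}R_+(\sigma^j(x))$. *)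

(* Defs.v *)
From HB Require Import structures.
From mathcomp Require Import all_boot all_order all_algebra.
From mathcomp Require Import all_classical all_reals all_analysis.

Set Implicit Arguments.
Unset Strict Implicit.
Unset Printing Implicit Defensive.

Import Order.TTheory GRing.Theory Num.Theory.
Import numFieldNormedType.Exports.

Local Open Scope classical_set_scope.
Local Open Scope ring_scope.

Notation "\sum_ ( m <= i '<oo' ) F" :=
  (\big[+%R/0%R]_(m <= i <oo) F%R) : ring_scope.

(* {0,1}^{1,2,3,...} with the product topology and its Borel sigma-algebra.
   Coordinates are indexed from 0: [x i] is the mathematical x_{i+1};
   [false] is the symbol 0 and [true] the symbol 1. *)
Definition binseq : Type := cantor_space.

HB.instance Definition _ := Topological.copy binseq cantor_space.
HB.instance Definition _ := Pointed.copy binseq cantor_space.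

HB.instance Definition _ :=
  Measurable.copy binseq (g_sigma_algebraType (@open binseq)).

Definition zeros : binseq := fun=> false.
Definition ones : binseq := fun=> true.

Definition shift_map (x : binseq) : binseq := fun i => x i.+1.

Definition prepend (w : seq bool) (y : binseq) : binseq :=
  fun i => if (i < size w)%N then nth false w i else y (i - size w)%N.

Definition cylinder (w : seq bool) : set binseq :=
  [set x | forall i, (i < size w)%N -> x i = nth false w i].

(* The exponent is shifted by one because the first coordinate has index 1. *)
Definition dtheta (R : realType) (theta : R) (x y : binseq) : R :=
  if pselect (exists i, x i != y i) is left neq_xy
  then theta ^+ (ex_minn neq_xy).+1 else 0.

Lemma dtheta_lt (R : realType) (theta : R) (x y : binseq) (n : nat) :
  0 < theta < 1 ->
  dtheta theta x y < theta ^+ n <-> forall i, (i < n)%N -> y i = x i.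
Proof.
move=> /andP[t0 t1]; rewrite /dtheta; case: pselect => [h|h]; last first.
  split=> [_ i _|_]; last exact: exprn_gt0.
  by apply/eqP/negPn/negP => yx; apply: h; exists i; rewrite eq_sym.
case: ex_minnP => k xyk kmin; rewrite ltr_iXn2l//; split=> [nk i ilen|yx].
  apply/esym/eqP/negPn/negP => /kmin ki.
  by move: (leq_trans ilen nk); rewrite ltnNge ki.
rewrite ltnS leqNgt; apply/negP => kn.
by move: xyk; rewrite (yx _ kn) eqxx.
Qed.

(* The product topology on [binseq] is the topology of d_theta. *)
Lemma nbhs_dtheta (R : realType) (theta : R) (x : binseq) (A : set binseq) :
  0 < theta < 1 ->
  nbhs x A <-> exists2 e : R, 0 < e & forall y, dtheta theta x y < e -> A y.
Proof.
move=> t01; have /andP[t0 t1] := t01; split.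
  move=> xA; apply: contrapT => nA.
  have {}nA n : exists y : binseq, (forall i, (i < n)%N -> y i = x i) /\ ~ A y.
    apply: contrapT => h; apply: nA; exists (theta ^+ n); first exact: exprn_gt0.
    move=> y /(dtheta_lt _ _ _ t01) yx; apply: contrapT => nAy.
    by apply: h; exists y.
  have [u hu] := choice nA.
  have ux : u n @[n --> \oo] --> (x : {ptws nat -> bool}).
    apply/pointwise_cvgP => i B /nbhs_singleton Bx.
    by exists i.+1 => // n /= ilen; rewrite /= (hu n).1.
  have [N _ /(_ N (leqnn N))] := ux _ xA.
  exact: (hu N).2.
move=> [e e0 eA].
have [n ne] : exists n, theta ^+ n < e.
  have : theta ^+ n @[n --> \oo] --> (0 : R) by apply: cvg_expr; rewrite gtr0_norm.
  move=> /cvgrPdist_lt /(_ _ e0) [n _ /(_ n (leqnn n))].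
  by rewrite /= sub0r normrN gtr0_norm ?exprn_gt0// => ?; exists n.
suff : nbhs x [set y : binseq | forall i, (i < n)%N -> y i = x i].
  apply: filterS => y /(dtheta_lt _ _ _ t01) xy; apply: eA; exact: lt_trans xy ne.
elim: n {ne} => [|n IH]; first by apply: filterS filterT => y _ i.
have xn : nbhs x [set y : binseq | y n = x n].
  by apply: (@proj_continuous nat (fun=> bool) n x [set x n]).
apply: filterS2 IH xn => y yx yn i.
by rewrite ltnS leq_eqVlt => /predU1P[->//|]; exact: yx.
Qed.

Definition dtheta_lipschitz (R : realType) (theta : R) (f : binseq -> R) :=
  exists K : R, forall x y, `|f x - f y| <= K * dtheta theta x y.

Definition birkhoff_sum (R : realType) (g : binseq -> R) (n : nat) (x : binseq)
  : R := \sum_(j < n) g (iter j shift_map x).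

Section entropy.
Context {R : realType}.
Implicit Types (m : probability binseq R) (g : binseq -> R).

Definition shift_invariant m :=
  forall A : set binseq, measurable A -> m (shift_map @^-1` A) = m A.

(* A finite partition is encoded by the map sending a point to the label of
   its atom; empty atoms contribute 0, since [0 * ln 0 = 0]. *)
Definition measurable_partition (T : finType) (p : binseq -> T) :=
  forall t : T, measurable (p @^-1` [set t]).

Definition partition_entropy m (T : finType) (p : binseq -> T) : R :=
  - \sum_(t : T) fine (m (p @^-1` [set t])) * ln (fine (m (p @^-1` [set t]))).

(* The join of p, sigma^{-1} p, ..., sigma^{-(n-1)} p. *)
Definition iterated_join (T : finType) (p : binseq -> T) (n : nat)
  : binseq -> {ffun 'I_n -> T} :=
  fun x => [ffun i : 'I_n => p (iter i shift_map x)].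

Definition entropy_rate m (T : finType) (p : binseq -> T) : R :=
  limn (fun n : nat => n%:R^-1 * partition_entropy m (iterated_join p n)).

Definition ks_entropy m : \bar R :=
  ereal_sup [set h | exists k (p : binseq -> 'I_k),
    measurable_partition p /\ h = (entropy_rate m p)%:E].

Definition free_energy g m : \bar R :=
  (\int[m]_x (g x)%:E + ks_entropy m)%E.

Definition pressure g : \bar R :=
  ereal_sup [set free_energy g m | m in shift_invariant].

Definition attains_pressure g m :=
  shift_invariant m /\ free_energy g m = pressure g.

(* Uniqueness is equality on Borel sets. *)
Definition is_equilibrium_measure g m :=
  attains_pressure g m /\
  forall m', attains_pressure g m' ->
    forall A : set binseq, measurable A -> m' A = m A.

End entropy.

(* [lne] is the extended logarithm, with [lne 0 = -oo]. *)
Definition large_deviation_principle (R : realType)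
    (mu : R -> probability binseq R) (I : binseq -> \bar R) :=
  [/\ forall x, (0 <= I x)%E,
      lower_semicontinuous I &
      forall w : seq bool,
        ((beta^-1)%:E * lne (mu beta (cylinder w)))%E @[beta --> +oo%R]
          --> (- ereal_inf [set I x | x in cylinder w])%E].

(* Main.v *)
Require Import Defs.
From HB Require Import structures.
From mathcomp Require Import all_boot all_order all_algebra.
From mathcomp Require Import all_classical all_reals all_analysis.
From mathcomp Require Import measurable_realfun.
From mathcomp Require Import ring lra zify.
Set Implicit Arguments.
Unset Strict Implicit.
Unset Printing Implicit Defensive.
Import Order.TTheory GRing.Theory Num.Theory.
Import numFieldNormedType.Exports.
Local Open Scope classical_set_scope.
Local Open Scope ring_scope.

(** The potential only sees the first run of equal symbols, so the equilibrium
    measure of [beta * f] is an explicit stationary renewal process, alternating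
    independent runs of zeros and of ones, and the large deviations can be read
    off its cylinder masses.

    Let [G s n] be the sum of [f] over a run of [n] symbols [s] and [L s] its limit.
    A run of [s] of length [n] gets the weight [exp (beta * G s n) * x ^ n], where
    [x] in ]0, 1[ is such that the two normalizing series have product 1
    ([pressure_equation]). The renewal process with these run-length laws is
    constructed from its cylinder masses, by coding the points of [0, 1[ through
    nested intervals ([probability_of_cylinder_masses], [renewal_probability]). It
    has the Gibbs property with pressure [- ln x], since the normalizing factors of
    consecutive runs cancel ([cylinder_mass_gibbs]). A Gibbs measure attains the
    pressure ([gibbs_measure_attains_pressure]): the entropy of an invariant measure
    is computed on the coordinate partition ([ks_entropy_le]), and Gibbs'
    inequality against the Gibbs measure bounds it. As the equilibrium measure is
    unique, its cylinder masses are now explicit ([equilibrium_run_cylinder_mass]).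

    Next, [beta] tends to infinity. Put [K = b + d + \sum c_j]. The condition
    [\sum a_j < K] makes long runs of zeros negligible in the pressure equation,
    and [1 - x] has exponential rate [K] ([has_rate_eps]). Every cylinder mass then
    has a rate ([has_rate_cylinder_mass]), because it is a product of run
    probabilities and of tails of geometrically decaying series.

    Finally, let [J w] be minus the rate of the mass of the cylinder of [w]. As
    masses add up, [J w] is the minimum of [J] over the two one-letter extensions
    of [w]. Hence [I x], the supremum of [J] over the prefixes of [x], is lower
    semicontinuous with infimum [J w] over the cylinder of [w]
    ([ereal_inf_deviation_function]). Prepending a letter to a long enough prefix
    changes [J] by exactly [R_+] ([cylinder_cost_shift]), so that
    [I x = R_+ x + I (shift x)]; with the values of [I] at the two fixed points this
    gives the announced formula on eventually constant points. On the other points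
    [I] is infinite, since each of their infinitely many switches from 0 to 1 costs
    at least [- b]. *)

(** * Cylinders and the Borel sets of the shift space *)

Lemma cylinderP (w : seq bool) (x : binseq) :
  cylinder w x <-> mkseq x (size w) = w.
Proof.
split=> [wx|<-]; last first.
  by move=> i; rewrite size_mkseq => iw; rewrite nth_mkseq.
apply: (@eq_from_nth _ false); rewrite size_mkseq// => i iw.
by rewrite nth_mkseq// wx.
Qed.

Lemma cylinder_mkseq (x y : binseq) (n : nat) :
  cylinder (mkseq x n) y <-> forall i, (i < n)%N -> y i = x i.
Proof.
rewrite /cylinder /= size_mkseq.
by split=> yx i ni; rewrite yx// nth_mkseq.
Qed.

Lemma mkseq_shift (x : binseq) n : mkseq x n.+1 = x 0%N :: mkseq (shift_map x) n.
Proof. by rewrite /mkseq /= -[1%N]addn0 iotaDl -map_comp. Qed.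

Lemma nbhs_cylinder (x : binseq) (A : set binseq) :
  nbhs x A <-> exists n, cylinder (mkseq x n) `<=` A.
Proof.
split=> [xA|[n nA]].
  apply: contrapT => nA.
  have {}nA n : exists y, cylinder (mkseq x n) y /\ ~ A y.
    apply: contrapT => h; apply: nA; exists n => y xy.
    by apply: contrapT => nAy; apply: h; exists y.
  have [u hu] := choice nA.
  have ux : u n @[n --> \oo] --> (x : {ptws nat -> bool}).
    apply/pointwise_cvgP => i B /nbhs_singleton Bx.
    by exists i.+1 => // n /= ilen; rewrite /= ((cylinder_mkseq _ _ _).1 (hu n).1).
  have [N _ /(_ N (leqnn N))] := ux _ xA.
  exact: (hu N).2.
suff : nbhs x (cylinder (mkseq x n)) by exact: filterS.
have -> : cylinder (mkseq x n) = [set y : binseq | forall i, (i < n)%N -> y i = x i].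
  by apply/seteqP; split => y /cylinder_mkseq.
elim: n {nA} => [|n IH]; first by apply: filterS filterT => y _ i.
have xn : nbhs x [set y : binseq | y n = x n].
  by apply: (@proj_continuous nat (fun=> bool) n x [set x n]).
apply: filterS2 IH xn => y yx yn i.
by rewrite ltnS leq_eqVlt => /predU1P[->//|]; exact: yx.
Qed.

Lemma open_cylinder (w : seq bool) : open (cylinder w).
Proof.
rewrite openE => x /cylinderP wx; apply/nbhs_cylinder.
by exists (size w); rewrite wx.
Qed.

Lemma measurable_cylinder (w : seq bool) : measurable (cylinder w).
Proof. by apply: sub_sigma_algebra; exact: open_cylinder. Qed.

Lemma open_bigcup_cylinder (A : set binseq) : open A ->
  A = \bigcup_(n in [set: nat])
        (if unpickle n is Some w then
           if `[< cylinder w `<=` A >] then cylinder w else set0 else set0).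
Proof.
rewrite openE => Ao; apply/seteqP; split => [x Ax|x [n _]].
  have /nbhs_cylinder[n nA] := Ao _ Ax.
  exists (pickle (mkseq x n)) => //; rewrite pickleK; case: ifPn => [_|/asboolP//].
  exact/cylinder_mkseq.
by case: unpickle => // w; case: ifPn => // /asboolP wA /wA.
Qed.

(** Two cylinders are nested or disjoint, so adding the empty set makes them a
    pi-system, on which measures are compared. *)
Definition cylinder_or_empty : set (set binseq) :=
  [set A | A = set0 \/ exists w, A = cylinder w].

Lemma measurable_cylinder_or_empty : cylinder_or_empty `<=` measurable.
Proof. by move=> _ [->//|[w ->]]; exact: measurable_cylinder. Qed.

Lemma measurable_generated_by_cylinders :
  @measurable _ binseq = <<s cylinder_or_empty >>.
Proof.
apply/seteqP; split; last first.
  exact: (smallest_sub (sigma_algebra_measurable _) measurable_cylinder_or_empty).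
apply: smallest_sub; first exact: smallest_sigma_algebra.
move=> A /open_bigcup_cylinder ->.
have [_ _ cU] := smallest_sigma_algebra setT cylinder_or_empty.
by apply: cU => n; case: ifP => _; apply: sub_sigma_algebra;
  [right; eexists|left].
Qed.

Lemma setI_closed_cylinder_or_empty : setI_closed cylinder_or_empty.
Proof.
have two v w : (size v <= size w)%N ->
    cylinder_or_empty (cylinder v `&` cylinder w).
  move=> vw; have [e|ne] := eqVneq (take (size v) w) v.
    right; exists w; apply/seteqP; split => [x []//|x wx]; split => //.
    by move=> i iv; rewrite wx ?(leq_trans iv)// -[in RHS]e nth_take.
  left; apply/seteqP; split => // x [vx wx]; move/eqP: ne; apply.
  apply: (@eq_from_nth _ false); first by rewrite size_takel.
  move=> i; rewrite size_takel// => iv.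
  by rewrite nth_take// -vx// -wx ?(leq_trans iv).
move=> A B [->|[v ->]]; first by rewrite set0I; left.
move=> [->|[w ->]]; first by rewrite setI0; left.
have [|/ltnW] := leqP (size v) (size w); first exact: two.
by rewrite setIC; exact: two.
Qed.

Lemma measure_eq_of_cylinders (R : realType)
    (m1 m2 : {measure set binseq -> \bar R}) :
  (m1 setT < +oo)%E ->
  (forall w, m1 (cylinder w) = m2 (cylinder w)) ->
  forall A, measurable A -> m1 A = m2 A.
Proof.
move=> m1T m12; apply: (measure_unique cylinder_or_empty (fun=> setT)).
- exact: measurable_generated_by_cylinders.
- exact: setI_closed_cylinder_or_empty.
- by move=> _; right; exists [::]; apply/seteqP; split.
- by rewrite bigcup_const.
- by move=> _ [->|[w ->]]; rewrite ?measure0.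
- by [].
Qed.

Lemma shift_map_cylinder (w : seq bool) :
  shift_map @^-1` (cylinder w) =
  cylinder (false :: w) `|` cylinder (true :: w).
Proof.
apply/seteqP; split => [x wx|x].
  by case e : (x 0%N); [right|left]; move=> [|i] //=; rewrite ltnS => iw; exact: wx.
by move=> [] wx i iw; apply: (wx i.+1).
Qed.

Lemma cylinder_cons_disjoint (w : seq bool) :
  cylinder (false :: w) `&` cylinder (true :: w) = set0.
Proof.
by apply/seteqP; split => // x [/(_ 0%N isT) /= e /(_ 0%N isT)]; rewrite e.
Qed.

Lemma measurable_preimage_shift (A : set binseq) :
  measurable A -> measurable (shift_map @^-1` A).
Proof.
have sm : measurable_fun [set: binseq] shift_map.
  apply: (measurability _ measurable_generated_by_cylinders).
  move=> _ [_ [->|[w ->]] <-]; rewrite ?preimage_set0 ?setI0// setTI.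
  by rewrite shift_map_cylinder; apply: measurableU; exact: measurable_cylinder.
by move=> mA; rewrite -[X in measurable X]setTI; exact: sm.
Qed.

Lemma shift_invariant_of_cylinders (R : realType) (m : probability binseq R) :
  (forall w, (m (cylinder (false :: w)) + m (cylinder (true :: w)))%E =
             m (cylinder w)) -> shift_invariant m.
Proof.
move=> inv A mA.
have sm : measurable_fun [set: binseq] shift_map.
  by move=> _ B mB; rewrite setTI; exact: measurable_preimage_shift.
pose m2 : {mfun binseq >-> binseq} :=
  HB.pack shift_map (isMeasurableFun.Build _ _ _ _ _ sm).
apply/esym.
apply: (@measure_eq_of_cylinders R m (distribution m m2)) => //.
  by rewrite [X in (X < _)%E](probability_setT m) ltry.
move=> w; transitivity (m (shift_map @^-1` (cylinder w))) => //.
rewrite shift_map_cylinder [RHS]measureU//; first exact/esym/inv;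
  try exact: measurable_cylinder.
exact: cylinder_cons_disjoint.
Qed.

(** * A probability with prescribed cylinder masses *)

Section nested_interval_coding.
Context {R : realType}.
Variable rho : seq bool -> R.
Hypothesis rho_ge0 : forall w, 0 <= rho w.
Hypothesis rho_nil : rho [::] = 1.
Hypothesis rho_rcons : forall w,
  rho (rcons w false) + rho (rcons w true) = rho w.

Let left_end (w : seq bool) : R :=
  \sum_(i < size w) if nth false w i then rho (rcons (take i w) false) else 0.

Let left_end_rcons w b : left_end (rcons w b) =
  left_end w + if b then rho (rcons w false) else 0.
Proof.
rewrite /left_end size_rcons big_ord_recr /= nth_rcons ltnn eqxx; congr (_ + _).
  apply: eq_bigr => i _; rewrite nth_rcons ltn_ord -(cats1 w) takel_cat//.
  exact/ltnW/ltn_ord.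
by rewrite -(cats1 w b) takel_cat// take_size.
Qed.

(** The word [w] is given the interval of length [rho w] starting at
    [left_end w]; the two extensions of [w] split that interval, the one by
    [false] on the left. The coding of [t] records the intervals containing [t],
    so that it carries Lebesgue measure on [0, 1[ to the required law. *)
Fixpoint coding_word (n : nat) (t : R) : seq bool :=
  if n is k.+1 then
    let w := coding_word k t in
    rcons w (left_end w + rho (rcons w false) <= t)
  else [::].

Definition coding (t : R) : binseq := fun n => last false (coding_word n.+1 t).

Let mkseq_coding n t : mkseq (coding t) n = coding_word n t.
Proof.
elim: n => [//|n IH].
rewrite /mkseq -[n.+1]addn1 iotaD map_cat /= add0n -/(mkseq _ _) IH cats1.
by rewrite addn1 /coding /= last_rcons.
Qed.

Let coding_wordE n t w : size w = n -> 0 <= t < 1 ->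
  (coding_word n t == w) = (left_end w <= t < left_end w + rho w).
Proof.
move=> + t01; elim/last_ind: w n => [|w b IH] n.
  by move=> <- /=; rewrite /left_end big_ord0 add0r rho_nil eqxx t01.
rewrite size_rcons => <-; rewrite /= eqseq_rcons; have := IH _ erefl.
rewrite left_end_rcons; case: eqP => [->|_] /=.
  move=> /esym /andP[h1 h2]; have := rho_rcons w.
  case: b => r; rewrite ?eqb_id ?addr0.
    by rewrite -addrA r h2 andbT.
  by rewrite h1 /= eqbF_neg -ltNge.
move=> /esym/negbT; rewrite negb_and -ltNge -leNgt => h.
apply/esym/negbTE; rewrite negb_and -ltNge -leNgt.
have := rho_rcons w; have := rho_ge0 (rcons w true); have := rho_ge0 (rcons w false).
move=> r0 r1 r; apply/orP.
by case: b; case/orP: h => h; (try by left; lra); right; lra.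
Qed.

Let left_end_bounds w : 0 <= left_end w /\ left_end w + rho w <= 1.
Proof.
elim/last_ind: w => [|w b [h1 h2]].
  by rewrite /left_end big_ord0 add0r rho_nil.
rewrite left_end_rcons; have := rho_rcons w.
have := rho_ge0 (rcons w true); have := rho_ge0 (rcons w false).
by case: b; lra.
Qed.

Let coding_preimage_cylinder w :
  coding @^-1` (cylinder w) `&` `[0, 1[ =
  `[left_end w, (left_end w + rho w)[%classic.
Proof.
have [l0 l1] := left_end_bounds w.
apply/seteqP; split => [t|t] /=; rewrite !in_itv /=.
  by move=> [/cylinderP wt t01]; rewrite -(@coding_wordE (size w))// -mkseq_coding wt.
move=> /[dup] tw /andP[t1 t2].
have t01 : 0 <= t < 1 by apply/andP; lra.
split => //; apply/cylinderP.
by apply/eqP; rewrite mkseq_coding coding_wordE.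
Qed.

Let measurable_coding_preimage A : measurable A ->
  measurable (coding @^-1` A `&` `[0%R, 1%R[).
Proof.
move=> mA; rewrite setIC.
apply: (measurability _ measurable_generated_by_cylinders) => //.
move=> _ [_ [->|[w ->]] <-]; first by rewrite preimage_set0 setI0.
by rewrite setIC coding_preimage_cylinder.
Qed.

Definition coding_law (A : set binseq) : \bar R :=
  lebesgue_measure (coding @^-1` A `&` `[0%R, 1%R[).

Let coding_law0 : coding_law set0 = 0%E.
Proof. by rewrite /coding_law preimage_set0 set0I measure0. Qed.

Let coding_law_ge0 A : (0 <= coding_law A)%E.
Proof. exact: measure_ge0. Qed.

Let coding_law_sigma_additive : semi_sigma_additive coding_law.
Proof.
move=> F mF tF mUF; rewrite /coding_law preimage_bigcup setI_bigcupl.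
apply: measure_semi_sigma_additive.
- by move=> n; exact: measurable_coding_preimage.
- apply/trivIsetP => /= i j _ _ ij; rewrite setIACA -preimage_setI.
  by move/trivIsetP : tF => /(_ _ _ _ _ ij) ->//; rewrite preimage_set0 set0I.
- rewrite -setI_bigcupl -preimage_bigcup; exact: measurable_coding_preimage.
Qed.

HB.instance Definition _ := isMeasure.Build _ _ _ coding_law
  coding_law0 coding_law_ge0 coding_law_sigma_additive.

Let coding_law_cylinder w : coding_law (cylinder w) = (rho w)%:E.
Proof.
rewrite /coding_law coding_preimage_cylinder lebesgue_measure_itv /= lte_fin.
case: ltP => [_|]; first by rewrite -EFinD addrAC subrr add0r.
by rewrite gerDl => r0; congr (_%:E); apply: le_anti; rewrite r0 rho_ge0.
Qed.

Let coding_law_setT : coding_law setT = 1%E.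
Proof.
rewrite -rho_nil -coding_law_cylinder; congr coding_law.
by apply/seteqP; split.
Qed.

HB.instance Definition _ := Measure_isProbability.Build _ _ _
  coding_law coding_law_setT.

Lemma probability_of_cylinder_masses :
  exists m : probability binseq R, forall w, m (cylinder w) = (rho w)%:E.
Proof. by exists coding_law; exact: coding_law_cylinder. Qed.

End nested_interval_coding.

(** * Shannon entropy of finite partitions *)

Lemma ln_le_subr1 (R : realType) (x : R) : 0 < x -> ln x <= x - 1.
Proof.
by move=> x0; rewrite -[in ln _](subrK 1 x) addrC le_ln1Dx// ltrBrDr addNr.
Qed.

(** Termwise, [ln y <= y - 1] at [y = v t / u t]. *)
Lemma gibbs_inequality (R : realType) (T : finType) (u v : T -> R) :
  (forall t, 0 <= u t) -> (forall t, 0 <= v t) ->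
  (forall t, 0 < u t -> 0 < v t) -> \sum_t v t <= \sum_t u t ->
  - \sum_t u t * ln (u t) <= - \sum_t u t * ln (v t).
Proof.
move=> u0 v0 uv svu; rewrite lerN2 -subr_ge0 -sumrB.
have : \sum_t (u t - v t) <= \sum_t (u t * ln (u t) - u t * ln (v t)).
  apply: ler_sum => t _.
  have := u0 t; rewrite le_eqVlt => /predU1P[<-|ut].
    by rewrite !mul0r subrr sub0r oppr_le0.
  have vt := uv t ut.
  have := @ln_le_subr1 _ (v t / u t) (divr_gt0 vt ut).
  rewrite ln_div// => h.
  have : u t * (ln (v t) - ln (u t)) <= u t * (v t / u t - 1) by rewrite ler_wpM2l.
  have -> : u t * (v t / u t - 1) = v t - u t.
    by field; rewrite gt_eqF.
  lra.
apply: le_trans; by rewrite sumrB subr_ge0.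
Qed.

Section partition_entropy.
Context {R : realType}.
Variable m : probability binseq R.

Definition mass (A : set binseq) : R := fine (m A).

Lemma massE A : measurable A -> m A = (mass A)%:E.
Proof. by move=> mA; rewrite /mass fineK// fin_num_measure. Qed.

Lemma mass_ge0 A : 0 <= mass A.
Proof. by rewrite /mass fine_ge0. Qed.

Lemma massT : mass setT = 1.
Proof. by rewrite /mass [X in fine X](probability_setT m). Qed.

Lemma mass0 : mass set0 = 0.
Proof. by rewrite /mass measure0. Qed.

Lemma massU A B : measurable A -> measurable B -> A `&` B = set0 ->
  mass (A `|` B) = mass A + mass B.
Proof.
move=> mA mB AB; rewrite /mass measureU// fineD// fin_num_measure//.
Qed.

Lemma le_mass A B : measurable A -> measurable B -> A `<=` B -> mass A <= mass B.
Proof.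
move=> mA mB AB; rewrite /mass fine_le ?fin_num_measure//.
by apply: le_measure; rewrite ?inE.
Qed.

Lemma mass_le1 A : measurable A -> mass A <= 1.
Proof. by move=> mA; rewrite -massT; exact: le_mass. Qed.

Section one_partition.
Context {T : finType} (p : binseq -> T).
Hypothesis mp : measurable_partition p.

Lemma measurable_union_of_atoms (s : seq T) :
  measurable [set x | p x \in s].
Proof.
elim: s => [|t s IH]; first by rewrite (_ : [set x | _] = set0)//; apply/seteqP; split.
rewrite (_ : [set x | _] = p @^-1` [set t] `|` [set x | p x \in s]).
  exact: measurableU.
apply/seteqP; split => x /=; rewrite inE.
  by case/predU1P => [->|]; [left|right].
by case=> [->|->]; rewrite ?eqxx ?orbT.
Qed.

Lemma mass_partition A : measurable A ->
  mass A = \sum_t mass (A `&` p @^-1` [set t]).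
Proof.
move=> mA.
have part s : uniq s -> mass (A `&` [set x | p x \in s]) =
    \sum_(t <- s) mass (A `&` p @^-1` [set t]).
  elim: s => [_|t s IH /= /andP[ts us]].
    rewrite big_nil (_ : _ `&` _ = set0) ?mass0//.
    by apply/seteqP; split => // x [].
  rewrite big_cons -IH// -massU.
  - congr mass; apply/seteqP; split => x /=; rewrite inE.
      by case=> Ax /predU1P[->|]; [left|right].
    by case=> -[Ax ->]; split; rewrite ?eqxx ?orbT.
  - by apply: measurableI => //; exact: mp.
  - by apply: measurableI => //; exact: measurable_union_of_atoms.
  - apply/seteqP; split => // x [[_ /= ->] [_ /=]].
    by rewrite (negbTE ts).
rewrite -part ?index_enum_uniq//; congr mass; apply/seteqP; split => x //=.
  by split => //; rewrite mem_index_enum.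
by case.
Qed.

Lemma Rintegral_partition (g : binseq -> R) : m.-integrable setT (EFin \o g) ->
  \int[m]_x g x = \sum_t \int[m]_(x in p @^-1` [set t]) g x.
Proof.
move=> ig.
have part s : uniq s -> \int[m]_(x in [set x | p x \in s]) g x =
    \sum_(t <- s) \int[m]_(x in p @^-1` [set t]) g x.
  elim: s => [_|t s IH /= /andP[ts us]].
    by rewrite big_nil (_ : mkset _ = set0) ?Rintegral_set0//; apply/seteqP; split.
  rewrite big_cons -IH// -Rintegral_setU//.
  - congr Rintegral; apply/seteqP; split => x /=; rewrite inE.
      by case/predU1P => [->|]; [left|right].
    by case=> [->|->]; rewrite ?eqxx ?orbT.
  - exact: measurable_union_of_atoms.
  - apply: integrableS ig => //; apply: measurableU => //.
    exact: measurable_union_of_atoms.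
  - rewrite disj_set2E; apply/eqP/seteqP; split => // x [/= ->].
    by rewrite (negbTE ts).
rewrite -part ?index_enum_uniq//; congr Rintegral; apply/seteqP; split => x //=.
by rewrite mem_index_enum.
Qed.

Lemma sum_mass_le_Rintegral (g : binseq -> R) (psi : T -> R) :
  m.-integrable setT (EFin \o g) -> (forall x, psi (p x) <= g x) ->
  \sum_t mass (p @^-1` [set t]) * psi t <= \int[m]_x g x.
Proof.
move=> ig pg; rewrite Rintegral_partition//; apply: ler_sum => t _.
have mt : measurable (p @^-1` [set t]) by exact: mp.
rewrite mulrC -Rintegral_cst//; apply: le_Rintegral => //.
- apply/integrableP; split; first exact: measurable_cst.
  rewrite integral_cst//= massE//.
  by rewrite -EFinM ltry.
- exact: integrableS ig.
- by move=> x /= <-.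
Qed.

Lemma sum_mass_partition : \sum_t mass (p @^-1` [set t]) = 1.
Proof.
rewrite -massT (mass_partition measurableT).
by apply: eq_bigr => t _; rewrite setTI.
Qed.

Lemma partition_entropy_le_cross (v : T -> R) : (forall t, 0 < v t) ->
  \sum_t v t <= 1 ->
  partition_entropy m p <= - \sum_t mass (p @^-1` [set t]) * ln (v t).
Proof.
move=> v0 v1; apply: gibbs_inequality => //.
- by move=> t; exact: mass_ge0.
- by move=> t; exact: ltW.
- by rewrite sum_mass_partition.
Qed.

End one_partition.

Lemma measurable_partition_pair (T S : finType) (p : binseq -> T) (q : binseq -> S) :
  measurable_partition p -> measurable_partition q ->
  measurable_partition (fun x => (p x, q x)).
Proof.
move=> mp mq [t s]; rewrite (_ : _ @^-1` _ = p @^-1` [set t] `&` q @^-1` [set s]).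
  exact: measurableI.
by apply/seteqP; split => x /=; [case=> -> ->|case=> -> ->].
Qed.

Lemma mass_pair_atom (T S : finType) (p : binseq -> T) (q : binseq -> S) t s :
  mass ((fun x => (p x, q x)) @^-1` [set (t, s)]) =
  mass (p @^-1` [set t] `&` q @^-1` [set s]).
Proof.
by congr mass; apply/seteqP; split => x /=; [case=> -> ->|case=> -> ->].
Qed.

(** Expanding both entropies over the joint atoms, each nonempty joint atom is
    an atom of [q] inside an atom of [p], which has a larger mass. *)
Lemma partition_entropy_factor (T S : finType) (p : binseq -> T) (q : binseq -> S) :
  measurable_partition p -> measurable_partition q ->
  (forall x y, q x = q y -> p x = p y) ->
  partition_entropy m p <= partition_entropy m q.
Proof.
move=> mp mq pq; rewrite /partition_entropy lerN2.
rewrite -/(mass _).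
under eq_bigr => s _ do
  rewrite -/(mass _) [X in X * _](mass_partition mp (mq s)) mulr_suml.
under [leRHS]eq_bigr => t _ do
  rewrite -/(mass _) [X in X * _](mass_partition mq (mp t)) mulr_suml.
rewrite exchange_big /=; apply: ler_sum => t _; apply: ler_sum => s _.
have [e|ne] := eqVneq (q @^-1` [set s] `&` p @^-1` [set t]) set0.
  by rewrite [p @^-1` _ `&` _]setIC e mass0 !mul0r.
case/set0P: ne => x [/= qx px].
have sub : q @^-1` [set s] `<=` p @^-1` [set t].
  by move=> y /= qy; rewrite -px; apply: pq; rewrite qy.
rewrite [p @^-1` _ `&` _]setIC (setIidl sub).
have := mass_ge0 (q @^-1` [set s]); rewrite le_eqVlt => /predU1P[<-|s0].
  by rewrite !mul0r.
rewrite ler_wpM2l ?mass_ge0// ler_ln ?posrE//; last first.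
  by apply: lt_le_trans s0 _; apply: le_mass.
by apply: le_mass.
Qed.

(** Gibbs' inequality against the product of the two marginals. *)
Lemma partition_entropy_pair_le (T S : finType) (p : binseq -> T) (q : binseq -> S) :
  measurable_partition p -> measurable_partition q ->
  partition_entropy m (fun x => (p x, q x)) <=
  partition_entropy m p + partition_entropy m q.
Proof.
move=> mp mq; have mpq := measurable_partition_pair mp mq.
pose v ts := mass (p @^-1` [set ts.1]) * mass (q @^-1` [set ts.2]).
have uv t s : mass (p @^-1` [set t] `&` q @^-1` [set s]) <= mass (p @^-1` [set t]) /\
              mass (p @^-1` [set t] `&` q @^-1` [set s]) <= mass (q @^-1` [set s]).
  have mts : measurable (p @^-1` [set t] `&` q @^-1` [set s]) by exact: measurableI.
  by split; apply: le_mass => // x [].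
apply: (@le_trans _ _ (- \sum_ts mass ((fun x => (p x, q x)) @^-1` [set ts]) * ln (v ts))).
  apply: gibbs_inequality => //.
  - by move=> t; exact: mass_ge0.
  - by move=> [t s]; rewrite mulr_ge0// mass_ge0.
  - move=> [t s]; rewrite -/(mass _) mass_pair_atom => h.
    by have [h1 h2] := uv t s; rewrite mulr_gt0//= (lt_le_trans h).
  - rewrite -/(mass _) (sum_mass_partition mpq) /v.
    rewrite -(pair_bigA _ (fun t s => mass (p @^-1` [set t]) * mass (q @^-1` [set s]))) /=.
    under eq_bigr do rewrite -mulr_sumr sum_mass_partition// mulr1.
    by rewrite sum_mass_partition.
rewrite /partition_entropy -opprD lerN2.
have -> : \sum_t fine (m (p @^-1` [set t])) * ln (fine (m (p @^-1` [set t]))) =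
    \sum_t \sum_s mass (p @^-1` [set t] `&` q @^-1` [set s]) * ln (mass (p @^-1` [set t])).
  apply: eq_bigr => t _.
  by rewrite -/(mass _) [X in X * _](mass_partition mq (mp t)) mulr_suml.
have -> : \sum_s fine (m (q @^-1` [set s])) * ln (fine (m (q @^-1` [set s]))) =
    \sum_t \sum_s mass (p @^-1` [set t] `&` q @^-1` [set s]) * ln (mass (q @^-1` [set s])).
  rewrite exchange_big; apply: eq_bigr => s _ /=.
  rewrite -/(mass _) [X in X * _](mass_partition mp (mq s)) mulr_suml.
  by apply: eq_bigr => t _; rewrite setIC.
rewrite -big_split /=.
under eq_bigr do rewrite -big_split /=.
rewrite pair_bigA /=; apply: ler_sum => -[t s] _ /=; rewrite mass_pair_atom /v /=.
have [h1 h2] := uv t s.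
have := mass_ge0 (p @^-1` [set t] `&` q @^-1` [set s]).
rewrite le_eqVlt => /predU1P[<-|h]; first by rewrite !mul0r addr0.
by rewrite lnM ?posrE ?mulrDr// ?(lt_le_trans h).
Qed.

(** This follows from [ln y^-1 <= y^-1 - 1] at [y = sqrt x]; the square root is
    only there to give an explicit bound that vanishes with [x]. *)
Lemma xlnx_le_sqrt (x : R) : 0 <= x -> - (x * ln x) <= 2 * Num.sqrt x.
Proof.
rewrite le_eqVlt => /predU1P[<-|x0]; first by rewrite mul0r oppr0 sqrtr0 mulr0.
have y0 : 0 < Num.sqrt x by rewrite sqrtr_gt0.
have xy : x = Num.sqrt x * Num.sqrt x by rewrite -expr2 sqr_sqrtr// ltW.
set y := Num.sqrt x in y0 xy *; rewrite {}xy lnM ?posrE//.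
have := @ln_le_subr1 R y^-1; rewrite invr_gt0 => /(_ y0); rewrite lnV ?posrE// => h.
have : y * - ln y <= y * (y^-1 - 1) by rewrite ler_pM2l.
rewrite mulrBr mulfV ?gt_eqF// mulr1 => h2.
have : y * (y * - ln y) <= y * (1 - y) by rewrite ler_pM2l.
have := mulr_gt0 y0 y0; lra.
Qed.

(** The atom [None], of mass close to 1, contributes at most [delta], and each
    of the [k] others at most [2 * sqrt delta]. *)
Lemma partition_entropy_option_le (k : nat) (e : binseq -> option 'I_k) (delta : R) :
  measurable_partition e -> mass (e @^-1` [set None]) >= 1 - delta ->
  partition_entropy m e <= delta + 2 * k%:R * Num.sqrt delta.
Proof.
move=> me md; rewrite /partition_entropy -sumrN -/(mass _).
have sume : \sum_t mass (e @^-1` [set t]) = 1 by exact: sum_mass_partition.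
have xlnx0 (x : R) : 0 <= x -> - (x * ln x) <= 1 - x.
  rewrite le_eqVlt => /predU1P[<-|x0]; first by rewrite mul0r; lra.
  have := @ln_le_subr1 R x^-1; rewrite invr_gt0 => /(_ x0); rewrite lnV ?posrE// => h.
  have : x * - ln x <= x * (x^-1 - 1) by rewrite ler_pM2l.
  by rewrite mulrBr mulfV ?gt_eqF//; lra.
rewrite (bigD1 None) //=; apply: lerD.
  by apply: (le_trans (xlnx0 _ (mass_ge0 _))); lra.
rewrite (bigD1 None)//= in sume.
apply: (@le_trans _ _ (\sum_(i : option 'I_k | i != None) 2 * Num.sqrt delta)).
  apply: ler_sum => t tN; apply: (le_trans (xlnx_le_sqrt (mass_ge0 _))).
  rewrite ler_pM2l// ler_sqrt; last first.
    by have := mass_le1 (me None); lra.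
  rewrite (bigD1 t)//= in sume.
  have : 0 <= \sum_(i : option 'I_k | (i != None) && (i != t)) mass (e @^-1` [set i]).
    by apply: sumr_ge0 => i _; exact: mass_ge0.
  lra.
rewrite big_const iter_addr_0 (_ : #|_| = k).
  by rewrite -mulr_natl; lra.
have -> : #|(fun i : option 'I_k => i != None)| = #|predC1 (None : option 'I_k)|.
  by apply: fintype.eq_card => i; rewrite !inE.
by rewrite cardC1 card_option card_ord.
Qed.

End partition_entropy.

(** * The coordinate partition generates the entropy *)

Definition first_coordinates (n : nat) (x : binseq) : n.-tuple bool :=
  [tuple x i | i < n].

Lemma first_coordinatesE n x : first_coordinates n x = mkseq x n :> seq bool.
Proof.
apply: (@eq_from_nth _ false); rewrite size_tuple ?size_mkseq// => i ni.
rewrite nth_mkseq// -(tnth_nth _ (first_coordinates n x) (Ordinal ni)).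
by rewrite tnth_mktuple.
Qed.

Lemma first_coordinates_eqP n x y :
  first_coordinates n x = first_coordinates n y <->
  forall i, (i < n)%N -> x i = y i.
Proof.
split=> [/(congr1 val)/=|xy]; last first.
  by apply: eq_from_tnth => i; rewrite !tnth_mktuple xy.
rewrite !first_coordinatesE => xy i ni.
by rewrite -(@nth_mkseq _ false x n)// xy nth_mkseq.
Qed.

Lemma first_coordinates_atom n (t : n.-tuple bool) :
  first_coordinates n @^-1` [set t] = cylinder t.
Proof.
apply/seteqP; split => x /=.
  by move=> <-; rewrite first_coordinatesE; exact/cylinder_mkseq.
move=> /cylinderP; rewrite size_tuple => xt.
by apply: val_inj; rewrite /= first_coordinatesE.
Qed.

Lemma measurable_first_coordinates n : measurable_partition (first_coordinates n).
Proof. by move=> t; rewrite first_coordinates_atom; exact: measurable_cylinder. Qed.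

Lemma measurable_partition_factor (T S : finType) (p : binseq -> T) (q : binseq -> S) :
  measurable_partition q -> (forall x y, q x = q y -> p x = p y) ->
  measurable_partition p.
Proof.
move=> mq pq t.
have -> : p @^-1` [set t] =
    [set x | q x \in [seq s <- enum S | `[< exists2 y, q y = s & p y = t >]]].
  apply/seteqP; split => x /=; rewrite mem_filter mem_enum andbT.
    by move=> pxt; apply/asboolP; exists x.
  by move=> /asboolP[y qyx <-]; apply: pq.
exact: measurable_union_of_atoms.
Qed.

Lemma measurable_of_first_coordinates n (B : set binseq) :
  (forall x y, first_coordinates n x = first_coordinates n y -> B x -> B y) ->
  measurable B.
Proof.
move=> hB.
have : measurable_partition (fun x => `[< B x >]).
  apply: (measurable_partition_factor (@measurable_first_coordinates n)) => x y xy.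
  by apply/idP/idP => /asboolP Bx; apply/asboolP; apply: hB Bx.
move=> /(_ true); congr measurable; apply/seteqP; split => x /=.
  by move=> /asboolP.
by move=> Bx; apply/asboolP.
Qed.

Lemma measurable_iter_shift i (A : set binseq) :
  measurable A -> measurable (iter i shift_map @^-1` A).
Proof.
elim: i A => [//|i IH] A mA.
rewrite (_ : _ @^-1` _ = iter i shift_map @^-1` (shift_map @^-1` A))//.
by apply: IH; exact: measurable_preimage_shift.
Qed.

Lemma iter_shiftE i x j : iter i shift_map x j = x (i + j)%N.
Proof. by elim: i j => [//|i IH] j; rewrite /= /shift_map IH addnS. Qed.

Lemma cvg_invn_mul (R : realType) (K : R) : n%:R^-1 * K @[n --> \oo] --> 0.
Proof.
rewrite -[X in _ --> X](mul0r K); apply: cvgMr_tmp.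
by rewrite -cvg_shiftS; exact: cvg_harmonic.
Qed.

Section invariant_probability.
Context {R : realType}.
Variable m : probability binseq R.

(** [B] is a finite union of cylinders: membership is decided by the first [N]
    coordinates. The property is stable by complement and countable union, so it
    passes from cylinders to all Borel sets. *)
Definition cylinder_approximable (A : set binseq) :=
  forall e, 0 < e -> exists N (B : set binseq),
    [/\ forall x y, first_coordinates N x = first_coordinates N y -> B x -> B y,
        mass m (A `\` B) <= e & mass m (B `\` A) <= e].

Lemma depends_on_more N N' (B : set binseq) : (N <= N')%N ->
  (forall x y, first_coordinates N x = first_coordinates N y -> B x -> B y) ->
  forall x y, first_coordinates N' x = first_coordinates N' y -> B x -> B y.
Proof.
move=> NN' hB x y /first_coordinates_eqP xy; apply: hB.
by apply/first_coordinates_eqP => i iN; apply: xy; exact: leq_trans NN'.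
Qed.

Lemma mass_subU (A B C : set binseq) :
  measurable A -> measurable B -> measurable C -> A `<=` B `|` C ->
  mass m A <= mass m B + mass m C.
Proof.
move=> mA mB mC ABC.
have mBA : measurable (A `&` B) by exact: measurableI.
have mAB : measurable (A `\` B) by exact: measurableD.
rewrite (_ : A = (A `&` B) `|` (A `\` B)); last by rewrite setUIDK.
rewrite massU//; last first.
  by apply/seteqP; split => // x [[_ Bx] [_ /(_ Bx)]].
apply: lerD; apply: le_mass => //.
by move=> x [/ABC[Bx /(_ Bx)|]].
Qed.

Lemma mass_le_sum (I : eqType) (s : seq I) (F : I -> set binseq) A :
  measurable A -> (forall i, measurable (F i)) ->
  (forall x, A x -> exists2 i, i \in s & F i x) ->
  mass m A <= \sum_(i <- s) mass m (F i).
Proof.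
move=> mA mF; elim: s A mA => [|i s IH] A mA AF.
  rewrite big_nil (_ : A = set0) ?mass0//; apply/seteqP; split => // x /AF[].
  by [].
rewrite big_cons; have mAF : measurable (A `\` F i) by exact: measurableD.
apply: (@le_trans _ _ (mass m (F i) + mass m (A `\` F i))).
  apply: mass_subU => // x Ax; have [|nFi] := pselect (F i x); first by left.
  by right.
rewrite lerD2l; apply: IH => // x [/AF[j]]; rewrite inE => /predU1P[->//|js] Fjx _.
by exists j.
Qed.

Lemma cylinder_approximableC A : cylinder_approximable A ->
  cylinder_approximable (~` A).
Proof.
move=> hA e e0; have [N [B [hB AB BA]]] := hA e e0.
exists N, (~` B); split.
- by move=> x y xy nBx By; apply: nBx; apply: hB By; rewrite xy.
- by rewrite setDE setCK setIC -setDE.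
- by rewrite setDE setCK setIC -setDE.
Qed.

Lemma cylinder_approximable_setU A A' : measurable A -> measurable A' ->
  cylinder_approximable A -> cylinder_approximable A' ->
  cylinder_approximable (A `|` A').
Proof.
move=> mA mA' hA hA' e e0; have e2 : 0 < e / 2 by rewrite divr_gt0.
have [N [B [hB AB BA]]] := hA _ e2.
have [N' [B' [hB' AB' BA']]] := hA' _ e2.
have mB := measurable_of_first_coordinates hB.
have mB' := measurable_of_first_coordinates hB'.
exists (maxn N N'), (B `|` B'); split.
- move=> x y xy [Bx|Bx]; [left|right].
    exact: (depends_on_more (leq_maxl N N') hB xy).
  exact: (depends_on_more (leq_maxr N N') hB' xy).
- apply: (@le_trans _ _ (mass m (A `\` B) + mass m (A' `\` B'))); last by lra.
  apply: mass_subU; [| | |].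
  + by apply: measurableD; exact: measurableU.
  + exact: measurableD.
  + exact: measurableD.
  + by move=> x [[Ax|Ax] nB]; [left|right]; split => // Bx; apply: nB; [left|right].
- apply: (@le_trans _ _ (mass m (B `\` A) + mass m (B' `\` A'))); last by lra.
  apply: mass_subU; [| | |].
  + by apply: measurableD; exact: measurableU.
  + exact: measurableD.
  + exact: measurableD.
  + by move=> x [[Ax|Ax] nB]; [left|right]; split => // Bx; apply: nB; [left|right].
Qed.

(** Half of the error is spent on replacing the countable union by a finite one,
    which is possible by continuity of [m] from below. *)
Lemma cylinder_approximable_bigcup (F : nat -> set binseq) :
  (forall n, measurable (F n)) -> (forall n, cylinder_approximable (F n)) ->
  cylinder_approximable (\bigcup_n F n).
Proof.
move=> mF hF e e0; have e2 : 0 < e / 2 by rewrite divr_gt0.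
pose C n := \big[setU/set0]_(i < n) F i.
have mC n : measurable (C n) by exact: bigsetU_measurable.
have CU : \bigcup_n C n = \bigcup_n F n.
  apply/seteqP; split => [x [n _]|x [n _ Fx]].
    by rewrite /C -bigcup_mkord => -[i _ Fi]; exists i.
  by exists n.+1 => //; rewrite /C -bigcup_mkord; exists n => /=.
have mU : measurable (\bigcup_n F n) by exact: bigcup_measurable.
have CsubU n : C n `<=` \bigcup_n F n.
  by rewrite -CU; exact: bigcup_sup.
have hC n : cylinder_approximable (C n).
  elim: n => [|n IH].
    move=> e' e'0; exists 0%N, set0; rewrite /C big_ord0 setDv mass0.
    by split => //; exact: ltW.
  rewrite /C big_ord_recr.
  exact: (@cylinder_approximable_setU (C n) (F n)).
have /(@nondecreasing_cvg_mu _ _ _ m _ mC) : measurable (\bigcup_n C n) by rewrite CU.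
have Cmono : {homo C : n k / (n <= k)%N >-> (n <= k)%O}.
  by move=> n k nk; apply/subsetPset; exact: subset_bigsetU.
move=> /(_ Cmono); rewrite CU => cvgC.
have [n hn] : exists n, mass m (\bigcup_n F n) - mass m (C n) <= e / 2.
  have : mass m (C n) @[n --> \oo] --> mass m (\bigcup_n F n).
    by apply: fine_cvg; rewrite -massE.
  move=> /cvgrPdist_le /(_ _ e2) [n _ /(_ n (leqnn n)) /= h].
  by exists n; apply: le_trans h; exact: ler_norm.
have [N [B [hB CB BC]]] := hC n _ e2.
have mB := measurable_of_first_coordinates hB.
exists N, B; split => //.
- apply: (@le_trans _ _ (mass m ((\bigcup_n F n) `\` C n) + mass m (C n `\` B))).
    apply: mass_subU; try exact: measurableD.
    move=> x [Ux nBx]; have [Cx|nCx] := pselect (C n x); last by left.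
    by right.
  have : mass m (\bigcup_n F n) = mass m (C n) + mass m ((\bigcup_n F n) `\` C n).
    rewrite -massU ?setDUK ?setDIK//; last exact: measurableD.
  lra.
- apply: (@le_trans _ _ (mass m (B `\` C n))); last lra.
  apply: le_mass; try exact: measurableD.
  by move=> x [Bx nU]; split => // /CsubU.
Qed.

Lemma cylinder_approximable_measurable A : measurable A -> cylinder_approximable A.
Proof.
move=> mA; suff : @measurable _ binseq `<=`
    [set A | measurable A /\ cylinder_approximable A] by move=> /(_ _ mA)[].
rewrite [X in X `<=` _]measurable_generated_by_cylinders; apply: smallest_sub.
  split => /=.
  - split; first exact: measurable0.
    move=> e e0; exists 0%N, set0; rewrite setDv mass0.
    by split => //; exact: ltW.
  - move=> B [mB hB]; rewrite setTD.
    by split; [exact: measurableC|exact: cylinder_approximableC].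
  - move=> F hF; split; first by apply: bigcup_measurable => n _; exact: (hF n).1.
    by apply: cylinder_approximable_bigcup => n; [exact: (hF n).1|exact: (hF n).2].
move=> {mA}A GA; split; first exact: measurable_cylinder_or_empty.
case: GA => [->|[w ->]] e e0.
  by exists 0%N, set0; rewrite setDv mass0; split => //; exact: ltW.
exists (size w), (cylinder w); rewrite setDv mass0; split; [|exact: ltW..].
by move=> x y /first_coordinates_eqP xy wx i iw; rewrite -xy// wx.
Qed.

(** Each atom of [q] is approximated by a set of cylinders, and [r x] is the
    label of one of these sets containing [x]; where [r] and [q] differ, [x]
    lies in one of the symmetric differences. *)
Lemma partition_approximation (k : nat) (q : binseq -> 'I_k) (delta : R) :
  measurable_partition q -> 0 < delta ->
  exists N (r : binseq -> 'I_k),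
    (forall x y, first_coordinates N x = first_coordinates N y -> r x = r y) /\
    mass m [set x | q x != r x] <= delta.
Proof.
move=> mq d0.
have k0 : (0 < k)%N by case: k q mq => // q; case: (q zeros).
have dk : 0 < delta / (2 * k%:R) by rewrite divr_gt0// mulr_gt0// ltr0n.
have hq t : exists NB : nat * set binseq, 
    [/\ forall x y, first_coordinates NB.1 x = first_coordinates NB.1 y -> NB.2 x -> NB.2 y,
        mass m (q @^-1` [set t] `\` NB.2) <= delta / (2 * k%:R)
      & mass m (NB.2 `\` q @^-1` [set t]) <= delta / (2 * k%:R)].
  have [N [B h]] := cylinder_approximable_measurable (mq t) dk.
  by exists (N, B).
have [NB hNB] := choice hq.
pose N := (\max_(t < k) (NB t).1)%N.
pose r x := odflt (q zeros) [pick t | `[< (NB t).2 x >]].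
have rN x y : first_coordinates N x = first_coordinates N y -> r x = r y.
  move=> xy; rewrite /r; congr odflt; apply: eq_pick => t.
  have [h _ _] := hNB t.
  have h' := depends_on_more (leq_bigmax t : ((NB t).1 <= N)%N) h.
  by apply/idP/idP => /asboolP H; apply/asboolP; apply: h' H.
exists N, r; split => //.
have mr := measurable_partition_factor (@measurable_first_coordinates N) rN.
have mNB t : measurable (NB t).2.
  by have [h _ _] := hNB t; exact: measurable_of_first_coordinates h.
pose F t := (q @^-1` [set t] `\` (NB t).2) `|` ((NB t).2 `\` q @^-1` [set t]).
have mF t : measurable (F t) by apply: measurableU; apply: measurableD.
apply: (@le_trans _ _ (\sum_(t <- index_enum 'I_k) mass m (F t))).
  apply: mass_le_sum => //.
    have := measurable_union_of_atoms (measurable_partition_pair mq mr)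
      [seq ts <- enum {: 'I_k * 'I_k} | ts.1 != ts.2].
    rewrite (_ : [set x | _ \in _] = [set x | q x != r x])//.
    by apply/seteqP; split => x /=; rewrite mem_filter mem_enum andbT.
  move=> x /=; rewrite /r; case: pickP => [s /asboolP sx|none] /= qs.
    exists s; first by rewrite mem_index_enum.
    by right; split => //= qx; move: qs; rewrite qx eqxx.
  exists (q x); first by rewrite mem_index_enum.
  by left; split => //= h; have := none (q x); move=> /asboolP; apply.
apply: (@le_trans _ _ (\sum_(t < k) (delta / k%:R))).
  apply: ler_sum => t _; have [_ h1 h2] := hNB t.
  apply: (@le_trans _ _ (mass m (q @^-1` [set t] `\` (NB t).2) +
      mass m ((NB t).2 `\` q @^-1` [set t]))).
    apply: mass_subU => //; exact: measurableD.
  have -> : delta / k%:R = delta / (2 * k%:R) + delta / (2 * k%:R).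
    by field; rewrite pnatr_eq0 -lt0n.
  exact: lerD.
rewrite sumr_const card_ord -(mulr_natr (delta / k%:R)) divfK// pnatr_eq0 -lt0n//.
Qed.

Lemma measurable_iterated_join (T : finType) (p : binseq -> T) n :
  measurable_partition p -> measurable_partition (iterated_join p n).
Proof.
move=> mp; elim: n => [|n IH].
  move=> t; rewrite (_ : _ @^-1` _ = setT)//; apply/seteqP; split => // x _ /=.
  by apply/ffunP => -[].
have mpn : measurable_partition (p \o iter n shift_map).
  by move=> t; rewrite comp_preimage; exact: measurable_iter_shift.
apply: measurable_partition_factor (measurable_partition_pair IH mpn) _.
move=> x y [/ffunP xy pxy]; apply/ffunP => i; rewrite !ffunE.
have := ltn_ord i; rewrite ltnS leq_eqVlt => /predU1P[->//|ni].
by have := xy (Ordinal ni); rewrite !ffunE.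
Qed.

Hypothesis minv : shift_invariant m.

Lemma mass_iter_shift i A : measurable A -> mass m (iter i shift_map @^-1` A) = mass m A.
Proof.
elim: i A => [//|i IH] A mA.
rewrite (_ : _ @^-1` _ = iter i shift_map @^-1` (shift_map @^-1` A))//.
rewrite IH; first by rewrite /mass minv.
exact: measurable_preimage_shift.
Qed.

Lemma partition_entropy_shift (T : finType) (p : binseq -> T) i :
  measurable_partition p ->
  partition_entropy m (p \o iter i shift_map) = partition_entropy m p.
Proof.
move=> mp; congr (- _); apply: eq_bigr => t _.
by rewrite -!/(mass m _) comp_preimage mass_iter_shift.
Qed.

Lemma iterated_join_entropy_le (T : finType) (p : binseq -> T) n :
  measurable_partition p ->
  partition_entropy m (iterated_join p n) <= n%:R * partition_entropy m p.
Proof.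
move=> mp; elim: n => [|n IH].
  apply: (@le_trans _ _ (partition_entropy m (fun=> tt))).
    apply: partition_entropy_factor => //; first exact: measurable_iterated_join.
    - by move=> t; rewrite preimage_cst; case: ifP.
    - by move=> x y _; apply/ffunP => -[].
  rewrite mul0r /partition_entropy oppr_le0; apply: sumr_ge0 => -[] _.
  by rewrite preimage_cst in_set1 eqxx -/(mass m _) massT ln1 mulr0.
have mpn : measurable_partition (p \o iter n shift_map).
  by move=> t; rewrite comp_preimage; exact: measurable_iter_shift.
have mj := @measurable_iterated_join _ p n mp.
rewrite -natr1 mulrDl mul1r.
apply: (@le_trans _ _ (partition_entropy m
    (fun x => (iterated_join p n x, (p \o iter n shift_map) x)))).
  apply: partition_entropy_factor;
    [exact: measurable_iterated_join|exact: measurable_partition_pair|].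
  move=> x y [/ffunP xy pxy]; apply/ffunP => i; rewrite !ffunE.
  have := ltn_ord i; rewrite ltnS leq_eqVlt => /predU1P[->//|ni].
  by have := xy (Ordinal ni); rewrite !ffunE.
apply: le_trans (partition_entropy_pair_le _ _ _) _ => //.
by rewrite partition_entropy_shift// lerD2r.
Qed.

(** If [r] is a function of the first N coordinates that agrees with [q] up to
    a small set, the orbit of [q] is recovered from n + N coordinates and from
    the n corrections [e], whose entropy is small because they are rarely
    different from [None]. *)
Lemma iterated_join_entropy_le_coordinates (k : nat) (q : binseq -> 'I_k) (eta : R) :
  measurable_partition q -> 0 < eta ->
  exists N, forall n, partition_entropy m (iterated_join q n) <=
    partition_entropy m (first_coordinates (n + N)) + n%:R * eta.
Proof.
move=> mq eta0.
(* [delta] makes [delta + 2 * k * sqrt delta], a bound for the entropy of a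
   [k]-valued correction that is rarely needed, at most [eta] *)
pose delta := Num.min (eta / 2) ((eta / (2 * (2 * k%:R + 1))) ^+ 2).
have k1 : 0 < 2 * k%:R + 1 :> R by rewrite ltr_wpDl// mulr_ge0.
have d0 : 0 < delta.
  by rewrite lt_min; apply/andP; split; rewrite ?exprn_gt0// divr_gt0// mulr_gt0.
have small : delta + 2 * k%:R * Num.sqrt delta <= eta.
  have d1 : delta <= eta / 2 by rewrite ge_min lexx.
  have d2 : Num.sqrt delta <= eta / (2 * (2 * k%:R + 1)).
    rewrite -[leRHS]gtr0_norm; last by rewrite divr_gt0// mulr_gt0.
    by rewrite -sqrtr_sqr ler_sqrt ?sqr_ge0// ge_min lexx orbT.
  have : 2 * k%:R * Num.sqrt delta <= (2 * k%:R + 1) * (eta / (2 * (2 * k%:R + 1))).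
    by apply: ler_pM; rewrite ?mulr_ge0 ?sqrtr_ge0 ?lerDl.
  have -> : (2 * k%:R + 1) * (eta / (2 * (2 * k%:R + 1))) = eta / 2.
    by field; rewrite gt_eqF.
  lra.
have [N [r [rN qr]]] := partition_approximation mq d0.
have mr := measurable_partition_factor (@measurable_first_coordinates N) rN.
pose e x := if q x == r x then None else Some (q x).
have me : measurable_partition e.
  apply: measurable_partition_factor (measurable_partition_pair mq mr) _.
  by move=> x y [qxy rxy]; rewrite /e qxy rxy.
exists N => n.
apply: (@le_trans _ _ (partition_entropy m
    (fun x => (first_coordinates (n + N) x, iterated_join e n x)))).
  apply: partition_entropy_factor.
  - exact: measurable_iterated_join.
  - apply: measurable_partition_pair; first exact: measurable_first_coordinates.
    exact: measurable_iterated_join.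
  move=> x y xye; have /first_coordinates_eqP xy := congr1 fst xye.
  have /ffunP exy := congr1 snd xye; apply/ffunP => i.
  have := exy i; rewrite !ffunE /e.
  have -> : r (iter i shift_map x) = r (iter i shift_map y).
    apply: rN; apply/first_coordinates_eqP => j jN; rewrite !iter_shiftE xy//.
    by have := ltn_ord i; lia.
  by case: eqP => [->|_]; case: eqP => [->|_] // [].
apply: le_trans (partition_entropy_pair_le _ _ _) _.
- exact: measurable_first_coordinates.
- exact: measurable_iterated_join.
rewrite lerD2l; apply: le_trans (iterated_join_entropy_le _ _) _ => //.
apply: ler_wpM2l => //; apply: le_trans small.
apply: partition_entropy_option_le => //.
have mqr : measurable (e @^-1` [set None]) by exact: me.
have : mass m (e @^-1` [set None]) + mass m [set x | q x != r x] = 1.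
  rewrite -(massT m) -massU//.
  - congr mass; apply/seteqP; split => x //= _; rewrite /e.
    by case: eqP; [left|right].
  - rewrite (_ : [set x | _] = ~` (e @^-1` [set None])); first exact: measurableC.
    by apply/seteqP; split => x /=; rewrite /e; case: eqP.
  - by apply/seteqP; split => x //=; rewrite /e; case: eqP => // ? [].
lra.
Qed.

(** If the normalized entropies of some partition do not converge, the entropy
    rate is the default value [0], whence the hypothesis [0 <= h]. *)
Lemma ks_entropy_le (h C : R) : 0 <= h ->
  (forall n, partition_entropy m (first_coordinates n) <= n%:R * h + C) ->
  (ks_entropy m <= h%:E)%E.
Proof.
move=> h0 hC; apply: ge_ereal_sup => _ [k [p [mp ->]]].
rewrite lee_fin /entropy_rate.
set u := (fun n : nat => _).
have [cu|] := pselect (cvgn u); last first.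
  by move=> /dvg_inP du; rewrite [X in X <= _](du : limn u = point).
apply/ler_addgt0Pr => eta eta0; have eta2 : 0 < eta / 2 by rewrite divr_gt0.
have [N hN] := iterated_join_entropy_le_coordinates mp eta2.
apply: limr_le => //.
have := cvg_invn_mul (N%:R * h + C); move=> /cvgrPdist_le /(_ _ eta2) near0; near=> n.
have n0 : (0 < n)%N by near: n; exact: nbhs_infty_gt.
have nR : 0 < n%:R :> R by rewrite ltr0n.
have : `|0 - n%:R^-1 * (N%:R * h + C)| <= eta / 2 by near: n.
rewrite sub0r normrN => /(le_trans (ler_norm _)) small.
have := le_trans (hN n) (lerD (hC _) (lexx _)).
rewrite natrD => hn; rewrite /u.
apply: (@le_trans _ _ (n%:R^-1 * ((n%:R + N%:R) * h + C + n%:R * (eta / 2)))).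
  by rewrite ler_pM2l ?invr_gt0.
have -> : n%:R^-1 * ((n%:R + N%:R) * h + C + n%:R * (eta / 2)) =
    h + n%:R^-1 * (N%:R * h + C) + eta / 2.
  by field; rewrite gt_eqF.
lra.
Unshelve. all: by end_near.
Qed.

End invariant_probability.

Lemma ks_entropy_ge (R : realType) (m : probability binseq R) (h C : R) :
  (forall n, `|partition_entropy m (first_coordinates n) - n%:R * h| <= C) ->
  (h%:E <= ks_entropy m)%E.
Proof.
move=> hC; apply: ereal_sup_ubound; exists 2%N.
pose p (x : binseq) : 'I_2 := if x 0%N then 1 else 0.
have pE x y : p x = p y -> x 0%N = y 0%N.
  by rewrite /p; case: (x 0%N); case: (y 0%N).
have mp : measurable_partition p.
  apply: measurable_partition_factor (@measurable_first_coordinates 1) _ => x y.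
  by move=> /first_coordinates_eqP /(_ 0%N isT); rewrite /p => ->.
exists p; split => //; congr EFin; apply/esym/cvg_lim => //.
have joinE n : partition_entropy m (iterated_join p n) =
    partition_entropy m (first_coordinates n).
  have mj := @measurable_iterated_join _ p n mp.
  have mf := @measurable_first_coordinates n.
  apply/le_anti/andP; split; apply: partition_entropy_factor => // x y.
    move=> /first_coordinates_eqP xy; apply/ffunP => i; rewrite !ffunE.
    by rewrite /p !iter_shiftE addn0 xy.
  move=> /ffunP xy; apply/first_coordinates_eqP => i ni.
  by have := xy (Ordinal ni); rewrite !ffunE => /pE; rewrite /= !iter_shiftE addn0.
apply/cvgrPdist_le => e e0; near=> n.
have n0 : (0 < n)%N by near: n; exact: nbhs_infty_gt.
have nR : 0 < n%:R :> R by rewrite ltr0n.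
rewrite joinE distrC.
have -> : n%:R^-1 * partition_entropy m (first_coordinates n) - h =
    n%:R^-1 * (partition_entropy m (first_coordinates n) - n%:R * h).
  by field; rewrite gt_eqF.
rewrite normrM ger0_norm ?invr_ge0//.
apply: (@le_trans _ _ (n%:R^-1 * C)); first by rewrite ler_pM2l ?invr_gt0.
have : `|0 - n%:R^-1 * C| <= e.
  by near: n; have /cvgrPdist_le := cvg_invn_mul C; exact.
by rewrite sub0r normrN => /(le_trans (ler_norm _)).
Unshelve. all: by end_near.
Qed.

(** * A Gibbs measure is an equilibrium measure *)

Section gibbs_measures.
Context {R : realType}.
Variables (phi : binseq -> R) (P : R).
Hypothesis mphi : measurable_fun [set: binseq] phi.
Hypothesis bphi : [bounded phi x | x in [set: binseq]].

Lemma integrable_bounded (m : probability binseq R) : m.-integrable setT (EFin \o phi).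
Proof.
apply: measurable_bounded_integrable => //.
by rewrite [X in (X < _)%E](probability_setT m) ltry.
Qed.

Lemma measurable_fun_iter_shift i : measurable_fun [set: binseq] (iter i shift_map).
Proof. by move=> _ A mA; rewrite setTI; exact: measurable_iter_shift. Qed.

Lemma integrable_iter_shift (m : probability binseq R) i :
  m.-integrable setT (EFin \o (phi \o iter i shift_map)).
Proof.
apply: measurable_bounded_integrable => //.
- by rewrite [X in (X < _)%E](probability_setT m) ltry.
- by apply: measurableT_comp => //; exact: measurable_fun_iter_shift.
- case: bphi => M [Mr hM]; exists M; split => // y My x _ /=; exact: hM.
Qed.

Lemma Rintegral_iter_shift (m : probability binseq R) i : shift_invariant m ->
  \int[m]_x phi (iter i shift_map x) = \int[m]_x phi x.
Proof.
move=> minv; rewrite /Rintegral; congr fine.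
have ms := measurable_fun_iter_shift i.
pose s : {mfun binseq >-> binseq} :=
  HB.pack (iter i shift_map) (isMeasurableFun.Build _ _ _ _ _ ms).
transitivity (\int[distribution m s]_x (phi x)%:E)%E; last first.
  apply: eq_measure_integral => A mA _; rewrite /distribution /pushforward /=.
  by have := mass_iter_shift minv i mA; rewrite (massE m mA) => <-; rewrite -massE//;
    exact: measurable_iter_shift.
apply/esym; rewrite (@integral_pushforward _ _ _ _ _ _ ms m setT (EFin \o phi))//.
  exact/measurable_EFinP.
by rewrite preimage_setT; exact: integrable_iter_shift.
Qed.

Lemma integrable_birkhoff_sum (m : probability binseq R) n :
  m.-integrable setT (EFin \o birkhoff_sum phi n).
Proof.
rewrite (_ : EFin \o _ = (fun x => \sum_(j <- enum 'I_n) (phi (iter j shift_map x))%:E)%E).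
  by apply: integrable_sum => // i _; exact: integrable_iter_shift.
by apply/funext => x /=; rewrite big_enum sumEFin.
Qed.

Lemma Rintegral_birkhoff_sum (m : probability binseq R) n : shift_invariant m ->
  \int[m]_x birkhoff_sum phi n x = n%:R * \int[m]_x phi x.
Proof.
move=> minv; elim: n => [|n IH].
  rewrite mul0r (_ : birkhoff_sum phi 0 = cst 0).
    by rewrite Rintegral_cst// mul0r.
  by apply/funext => x; rewrite /birkhoff_sum big_ord0.
rewrite -natr1 mulrDl mul1r -IH -(Rintegral_iter_shift n minv) -RintegralD//.
- by apply: eq_Rintegral => x _; rewrite /birkhoff_sum big_ord_recr.
- exact: integrable_birkhoff_sum.
- exact: integrable_iter_shift.
Qed.

Variables (nu : probability binseq R) (C : R).
Hypothesis nu_gt0 : forall w, 0 < mass nu (cylinder w).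
Hypothesis nu_gibbs : forall n x,
  `|ln (mass nu (cylinder (mkseq x n))) - (birkhoff_sum phi n x - n%:R * P)| <= C.

Let Rintegral_affine (m : probability binseq R) n (k K : R) : shift_invariant m ->
  \int[m]_x (k * birkhoff_sum phi n x + K) = k * (n%:R * \int[m]_x phi x) + K.
Proof.
move=> minv; have ib := integrable_birkhoff_sum m n.
rewrite RintegralD//.
- rewrite RintegralZl// Rintegral_birkhoff_sum// Rintegral_cst//.
  by rewrite -/(mass m _) massT mulr1.
- rewrite (_ : EFin \o _ = (fun x => k%:E * (birkhoff_sum phi n x)%:E)%E)//.
  exact: integrableZl.
- exact: finite_measure_integrable_cst.
Qed.

Let integrable_affine (m : probability binseq R) n (k K : R) :
  m.-integrable setT (EFin \o (fun x => k * birkhoff_sum phi n x + K)).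
Proof.
rewrite (_ : EFin \o _ = (fun x => k%:E * (birkhoff_sum phi n x)%:E + K%:E)%E)//.
apply: integrableD => //; last exact: finite_measure_integrable_cst.
by apply: integrableZl => //; exact: integrable_birkhoff_sum.
Qed.

Let mass_atom n (t : n.-tuple bool) :
  mass nu (first_coordinates n @^-1` [set t]) = mass nu (cylinder t).
Proof. by rewrite first_coordinates_atom. Qed.

(** Gibbs' inequality against [nu], whose cylinder masses are given, up to a
    bounded factor, by the Birkhoff sums of [phi]. *)
Lemma gibbs_entropy_upper (m : probability binseq R) n : shift_invariant m ->
  partition_entropy m (first_coordinates n) <= n%:R * (P - \int[m]_x phi x) + C.
Proof.
move=> minv; have mf := @measurable_first_coordinates n.
apply: (@le_trans _ _ (- \sum_(t : n.-tuple bool)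
    mass m (first_coordinates n @^-1` [set t]) * ln (mass nu (cylinder t)))).
  apply: partition_entropy_le_cross => //.
  by rewrite -(sum_mass_partition nu mf); under [leRHS]eq_bigr do rewrite mass_atom.
rewrite -sumrN; under eq_bigr do rewrite -mulrN.
have -> : n%:R * (P - \int[m]_x phi x) + C =
    \int[m]_x (-1 * birkhoff_sum phi n x + (n%:R * P + C)).
  by rewrite Rintegral_affine//; ring.
apply: sum_mass_le_Rintegral => [//||x]; first exact: integrable_affine.
rewrite first_coordinatesE; have := nu_gibbs n x; rewrite ler_norml => /andP[]; lra.
Qed.

Lemma gibbs_entropy_lower n : shift_invariant nu ->
  n%:R * (P - \int[nu]_x phi x) - C <= partition_entropy nu (first_coordinates n).
Proof.
move=> nuinv; have mf := @measurable_first_coordinates n.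
rewrite /partition_entropy lerNr -/(mass _ _).
have -> : - (n%:R * (P - \int[nu]_x phi x) - C) =
    \int[nu]_x (1 * birkhoff_sum phi n x + (- (n%:R * P) + C)).
  by rewrite Rintegral_affine//; ring.
apply: (sum_mass_le_Rintegral mf (psi := fun t => ln (mass nu
   (first_coordinates n @^-1` [set t])))) => [|x]; first exact: integrable_affine.
rewrite mass_atom first_coordinatesE; have := nu_gibbs n x.
by rewrite ler_norml => /andP[]; lra.
Qed.

(** The free energy of any invariant probability is at most [P], and that of
    [nu] is [P], because the entropy of [n] coordinates is bounded by, and for
    [nu] equal to, [n * (P - \int phi)] up to a constant. *)
Lemma gibbs_measure_attains_pressure : shift_invariant nu ->
  (forall x, phi x <= P) -> attains_pressure phi nu.
Proof.
move=> nuinv phiP.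
have int_le (m : probability binseq R) : 0 <= P - \int[m]_x phi x.
  rewrite subr_ge0 -[leRHS]mulr1 -(massT m) -Rintegral_cst//.
  apply: le_Rintegral => //; first exact: integrable_bounded.
  exact: finite_measure_integrable_cst.
have free (m : probability binseq R) : shift_invariant m -> (free_energy phi m <= P%:E)%E.
  move=> minv; rewrite /free_energy.
  have -> : (\int[m]_x (phi x)%:E)%E = (\int[m]_x phi x)%:E.
    by rewrite /Rintegral fineK//; exact/integrable_fin_num/integrable_bounded.
  have -> : P%:E = ((\int[m]_x phi x)%:E + (P - \int[m]_x phi x)%:E)%E.
    by rewrite -EFinD; congr EFin; ring.
  by rewrite leeD2lE//; apply: (ks_entropy_le minv (C := C)) => // n; exact: gibbs_entropy_upper.
have freenu : free_energy phi nu = P%:E.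
  apply/le_anti/andP; split; first exact: free.
  rewrite /free_energy.
  have -> : (\int[nu]_x (phi x)%:E)%E = (\int[nu]_x phi x)%:E.
    by rewrite /Rintegral fineK//; exact/integrable_fin_num/integrable_bounded.
  have -> : P%:E = ((\int[nu]_x phi x)%:E + (P - \int[nu]_x phi x)%:E)%E.
    by rewrite -EFinD; congr EFin; ring.
  rewrite leeD2lE//; apply: (ks_entropy_ge (C := C)) => n.
  have := gibbs_entropy_lower n nuinv; have := gibbs_entropy_upper n nuinv.
  by rewrite ler_norml => h1 h2; apply/andP; split; lra.
split => //; rewrite freenu; apply/le_anti/andP; split.
  by rewrite -freenu; apply: ereal_sup_ubound; exists nu.
by apply: ge_ereal_sup => _ [m minv <-]; exact: free.
Qed.

End gibbs_measures.

(** * The stationary alternating renewal process *)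

(** Runs of zeros and runs of ones alternate; they are independent, a run of
    symbol [s] having length [n] with probability [P s n] and length at least [n]
    with probability [T s n], where [TT s n] is the sum of [T s k] over [k >= n].
    [renewal_weight s k w] is the probability that a run of [s] just started has
    length at least [k] and is followed, after its [k]-th symbol, by [w]. In
    [stationary_weight] the run in progress at time 0 is counted once for each of
    its possible starting times, which replaces [P] by [T] and [T] by [TT]. *)
Section alternating_renewal.
Context {R : realType}.
Variables P T TT : bool -> nat -> R.

Fixpoint renewal_weight (s : bool) (k : nat) (w : seq bool) : R :=
  if w is b :: w' then
    if b == s then renewal_weight s k.+1 w' else P s k * renewal_weight b 1 w'
  else T s k.

Fixpoint stationary_weight (s : bool) (k : nat) (w : seq bool) : R :=
  if w is b :: w' then
    if b == s then stationary_weight s k.+1 w' else T s k * renewal_weight b 1 w'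
  else TT s k.

Definition mean_cycle : R := TT false 1 + TT true 1.

Definition cylinder_mass (w : seq bool) : R :=
  if w is s :: w' then stationary_weight s 1 w' / mean_cycle else 1.

Hypothesis P_gt0 : forall s n, 0 < P s n.
Hypothesis T_gt0 : forall s n, 0 < T s n.
Hypothesis TT_gt0 : forall s n, 0 < TT s n.
Hypothesis T1 : forall s, T s 1 = 1.
Hypothesis T_rec : forall s n, T s n = P s n + T s n.+1.
Hypothesis TT_rec : forall s n, TT s n = T s n + TT s n.+1.

Lemma mean_cycle_gt0 : 0 < mean_cycle.
Proof. by rewrite addr_gt0. Qed.

Lemma renewal_weight_gt0 s k w : 0 < renewal_weight s k w.
Proof.
elim: w s k => [//|b w IH] s k /=; case: ifP => _; first exact: IH.
by rewrite mulr_gt0.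
Qed.

Lemma stationary_weight_gt0 s k w : 0 < stationary_weight s k w.
Proof.
elim: w s k => [//|b w IH] s k /=; case: ifP => _; first exact: IH.
by rewrite mulr_gt0// renewal_weight_gt0.
Qed.

Lemma cylinder_mass_gt0 w : 0 < cylinder_mass w.
Proof.
case: w => [//|s w] /=.
by rewrite divr_gt0 ?mean_cycle_gt0 ?stationary_weight_gt0.
Qed.

Lemma renewal_weight_rcons s k w :
  renewal_weight s k (rcons w false) + renewal_weight s k (rcons w true) =
  renewal_weight s k w.
Proof.
elim: w s k => [|b w IH] s k /=.
  by rewrite !T1 !mulr1 [RHS]T_rec; case: s => //=; rewrite addrC.
by case: ifP => _; rewrite ?IH// -mulrDr IH.
Qed.

Lemma stationary_weight_rcons s k w :
  stationary_weight s k (rcons w false) + stationary_weight s k (rcons w true) =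
  stationary_weight s k w.
Proof.
elim: w s k => [|b w IH] s k /=.
  by rewrite !T1 !mulr1 [RHS]TT_rec; case: s => //=; rewrite addrC.
by case: ifP => _; rewrite ?IH// -mulrDr renewal_weight_rcons.
Qed.

Lemma cylinder_mass_rcons w :
  cylinder_mass (rcons w false) + cylinder_mass (rcons w true) = cylinder_mass w.
Proof.
case: w => [|s w] /=; rewrite -mulrDl ?stationary_weight_rcons//.
by rewrite divff// gt_eqF// mean_cycle_gt0.
Qed.

(** A first run of which [k] symbols are seen started either before them or
    exactly with the first of them. This is what makes the process stationary:
    prepending a letter to a word decides between the two. *)
Lemma stationary_weightS s k w :
  stationary_weight s k w = stationary_weight s k.+1 w + renewal_weight s k w.
Proof.
elim: w s k => [|b w IH] s k /=; first by rewrite TT_rec addrC.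
case: ifP => _; first exact: IH.
by rewrite [T s k]T_rec mulrDl; exact: addrC.
Qed.

Lemma cylinder_mass_cons w :
  cylinder_mass (false :: w) + cylinder_mass (true :: w) = cylinder_mass w.
Proof.
case: w => [|s w] /=; rewrite -mulrDl.
  by rewrite divff// gt_eqF// mean_cycle_gt0.
congr (_ / _); rewrite !T1 !mul1r [RHS]stationary_weightS.
by case: s => //=; rewrite addrC.
Qed.

Lemma renewal_probability : exists m : probability binseq R,
  shift_invariant m /\ forall w, m (cylinder w) = (cylinder_mass w)%:E.
Proof.
have [m hm] := @probability_of_cylinder_masses R cylinder_mass
  (fun w => ltW (cylinder_mass_gt0 w)) erefl cylinder_mass_rcons.
exists m; split => //; apply: shift_invariant_of_cylinders => w.
by rewrite !hm -EFinD cylinder_mass_cons.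
Qed.

(** The potential [phi] takes the value [g s n] on the points starting with
    exactly [n] symbols [s], so a whole run of length [n] has Birkhoff sum
    [G s n]. *)
Section gibbs_property.
Variables (phi : binseq -> R) (g : bool -> nat -> R) (p D K : R).
Variable kappa : bool -> R.
Let G s n := \sum_(1 <= j < n.+1) g s j.
Hypothesis g_le0 : forall s n, (0 < n)%N -> g s n <= 0.
Hypothesis G_ge : forall s n, - D <= G s n.
Hypothesis phi_run : forall s n, (0 < n)%N ->
  forall x, cylinder (rcons (nseq n s) (~~ s)) x -> phi x = g s n.
Hypothesis phi_const : forall s x, (forall i, x i = s) -> phi x = 0.
Hypothesis lnP : forall s n, (0 < n)%N -> ln (P s n) = G s n - n%:R * p - kappa s.
Hypothesis kappaD : kappa false + kappa true = 0.
Hypothesis K_ge1 : 1 <= K.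
Hypothesis T_le : forall s n, T s n <= K * P s n.
Hypothesis TT_le : forall s n, TT s n <= K * T s n.

Let G0 s : G s 0 = 0.
Proof. by rewrite /G big_geq. Qed.

Let GS s n : G s n.+1 = G s n + g s n.+1.
Proof. by rewrite /G big_nat_recr. Qed.

Let P_le_T s n : P s n <= T s n.
Proof. by rewrite [leRHS]T_rec lerDl ltW. Qed.

Let T_le_TT s n : T s n <= TT s n.
Proof. by rewrite [leRHS]TT_rec lerDl ltW. Qed.

Lemma stationary_weight_bounds s k w :
  renewal_weight s k w <= stationary_weight s k w <= K * renewal_weight s k w.
Proof.
elim: w s k => [|b w IH] s k /=; first by rewrite T_le_TT TT_le.
case: ifP => _; first exact: IH.
have r0 := renewal_weight_gt0 b 1 w.
by rewrite mulrA !ler_pM2r// P_le_T T_le.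
Qed.

Lemma G_le s k n : (k <= n)%N -> G s n <= G s k.
Proof.
move=> kn; rewrite /G (@big_cat_nat _ _ _ k.+1)//= gerDl.
rewrite big_nat_cond; apply: sumr_le0 => j /andP[/andP[kj _] _].
by apply: g_le0; exact: leq_trans kj.
Qed.

Lemma birkhoff_sumD n k x :
  birkhoff_sum phi (n + k) x = birkhoff_sum phi n x +
    birkhoff_sum phi k (iter n shift_map x).
Proof.
rewrite /birkhoff_sum big_split_ord; congr (_ + _).
by apply: eq_bigr => i _ /=; rewrite addnC iterD.
Qed.

Lemma birkhoff_sumS n x :
  birkhoff_sum phi n.+1 x = phi x + birkhoff_sum phi n (shift_map x).
Proof.
by rewrite -add1n birkhoff_sumD /birkhoff_sum big_ord_recl big_ord0 addr0.
Qed.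

Lemma birkhoff_sum_run s n r x : (r <= n)%N ->
  cylinder (rcons (nseq n s) (~~ s)) x ->
  birkhoff_sum phi r x = G s n - G s (n - r).
Proof.
elim: r n x => [|r IH] n x.
  by rewrite subn0 subrr /birkhoff_sum big_ord0.
case: n => // n; rewrite ltnS => rn xn.
rewrite birkhoff_sumS (phi_run _ xn)// (IH n)//.
  by rewrite subSS GS; ring.
by move=> i; rewrite size_rcons size_nseq => ni; rewrite /shift_map xn ?size_rcons ?size_nseq.
Qed.

(** A block of equal symbols belongs to a single run, possibly infinite, whose
    partial Birkhoff sums are differences of values of [G]. *)
Lemma birkhoff_sum_same_symbol s k x : (forall i, (i < k)%N -> x i = s) ->
  - D <= birkhoff_sum phi k x <= 0.
Proof.
move=> xs; have D0 : 0 <= D.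
  by have := G_ge s 0; rewrite G0 oppr_le0.
have [allx|nall] := pselect (forall i, x i = s).
  have -> : birkhoff_sum phi k x = 0.
    apply: big1 => i _; apply: (@phi_const s) => j.
    by rewrite iter_shiftE allx.
  by rewrite lexx oppr_le0 D0.
have ex : exists i, x i != s.
  apply: contrapT => h; apply: nall => i; apply/eqP/negPn/negP => h2.
  by apply: h; exists i.
have [n xn nmin] := ex_minnP ex.
have kn : (k <= n)%N.
  by rewrite leqNgt; apply/negP => /xs xns; rewrite xns eqxx in xn.
rewrite (@birkhoff_sum_run s n)//; last first.
  move=> i; rewrite size_rcons size_nseq ltnS leq_eqVlt nth_rcons size_nseq.
  case/predU1P => [->|ni].
    by rewrite ltnn eqxx; case: (x n) xn; case: (s).
  rewrite ni nth_nseq ni; apply/eqP/negPn/negP => /nmin.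
  by rewrite leqNgt ni.
have := G_ge s n; have := @G_le s 0 (n - k) (leq0n _).
have := @G_le s (n - k) n (leq_subr _ _).
by rewrite G0; lra.
Qed.

Lemma prepend_nseq_lt k s y i : (i < k)%N -> prepend (nseq k s) y i = s.
Proof. by move=> ik; rewrite /prepend size_nseq ik nth_nseq ik. Qed.

Lemma iter_shift_prepend w y : iter (size w) shift_map (prepend w y) = y.
Proof.
apply/funext => i; rewrite iter_shiftE /prepend ltnNge leq_addr /=.
by rewrite addKn.
Qed.

Let B := D + ln K + `|kappa true|.

Let ln_T_bounds s n : ln (P s n) <= ln (T s n) <= ln K + ln (P s n).
Proof.
rewrite -lnM ?posrE//; last exact: lt_le_trans K_ge1.
by rewrite !ler_ln ?posrE ?P_le_T ?T_le ?mulr_gt0// (lt_le_trans _ K_ge1).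
Qed.

(** A completed run of [s] has weight [exp] of its Birkhoff sum minus [p] times
    its length, divided by [exp (kappa s)]. Runs alternate and the two factors
    [exp (kappa s)] cancel, so that only the unfinished last run produces an
    error. *)
Lemma renewal_weight_gibbs s k w y : (0 < k)%N -> cylinder w y ->
  `|ln (renewal_weight s k w) + (if s then 0 else kappa false) -
    (birkhoff_sum phi (k + size w) (prepend (nseq k s) y) -
       (k + size w)%:R * p)| <= B.
Proof.
elim: w s k y => [|b w IH] s k y k0 wy /=.
  have := birkhoff_sum_same_symbol (fun i => @prepend_nseq_lt k s y i).
  have := @G_le s 0 k (leq0n _); rewrite G0 => Gk0.
  have := G_ge s k => Gge.
  have := ln_T_bounds s k; rewrite lnP// => /andP[h1 h2] /andP[h3 h4].
  have := ler_norm (kappa true); have := ler_norm (- kappa true).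
  rewrite normrN => n1 n2.
  have K0 : 0 <= ln K by rewrite ln_ge0.
  rewrite addn0 /B ler_norml; case: s h1 h2 h3 h4 Gk0 Gge => *; apply/andP; split; lra.
have y0 : y 0%N = b := wy 0%N isT.
have wy' : cylinder w (shift_map y) by move=> i iw; exact: (wy i.+1).
case: eqP => [bs|/eqP bs].
  rewrite addnS -addSn.
  have -> : prepend (nseq k s) y = prepend (nseq k.+1 s) (shift_map y).
    apply/funext => i; rewrite /prepend !size_nseq ltnS.
    case: (ltngtP i k) => ik; rewrite ?nth_nseq ?ltnS ?(ltnW ik) ?ik ?leqnn//.
      by rewrite /shift_map; congr (y _); lia.
    by rewrite subnn y0.
  exact: IH.
have -> : birkhoff_sum phi (k + (size w).+1) (prepend (nseq k s) y) =
    G s k + birkhoff_sum phi (1 + size w) y.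
  rewrite birkhoff_sumD (@birkhoff_sum_run s k)//.
    rewrite subnn G0 subr0 add1n.
    by rewrite -[X in iter X _ _](size_nseq k s) iter_shift_prepend.
  move=> i; rewrite size_rcons size_nseq ltnS leq_eqVlt nth_rcons size_nseq.
  case/predU1P => [->|ik]; last by rewrite prepend_nseq_lt// nth_nseq ik.
  by rewrite ltnn eqxx /prepend size_nseq ltnn subnn y0; case: (b) (s) bs => -[].
have yE : y = prepend (nseq 1 b) (shift_map y).
  by apply/funext => -[|i]; rewrite /prepend /= ?y0// subn1.
have := IH b 1%N _ isT wy'; rewrite -yE.
rewrite lnM ?posrE ?renewal_weight_gt0// lnP//.
have -> : (k + (size w).+1)%:R = k%:R + (1 + size w)%:R :> R by rewrite -natrD.
set E1 := ln (renewal_weight b 1 w); set S1 := birkhoff_sum phi _ y => h.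
apply: le_trans h; rewrite le_eqVlt; apply/orP; left; apply/eqP; congr `|_|.
by case: (s) (b) bs => -[]//= _; move: kappaD; lra.
Qed.

Lemma cylinder_mass_gibbs n x :
  `|ln (cylinder_mass (mkseq x n)) - (birkhoff_sum phi n x - n%:R * p)| <=
    B + ln K + `|ln mean_cycle| + `|kappa false|.
Proof.
have K0 : 0 <= ln K by rewrite ln_ge0.
have KK : 0 < K by apply: lt_le_trans K_ge1.
have D0 : 0 <= D.
  by have := G_ge false 0; rewrite G0 oppr_le0.
case: n => [|n].
  rewrite /= ln1 /birkhoff_sum big_ord0 mul0r !subr0 normr0 /B.
  by rewrite !addr_ge0.
rewrite mkseq_shift.
have wx : cylinder (mkseq (shift_map x) n) (shift_map x) by exact/cylinder_mkseq.
have := @renewal_weight_gibbs (x 0%N) 1 _ _ isT wx.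
rewrite size_mkseq -add1n.
have <- : x = prepend (nseq 1 (x 0%N)) (shift_map x).
  by apply/funext => -[|i]; rewrite /prepend //= subn1.
rewrite /= lnM ?posrE ?invr_gt0 ?mean_cycle_gt0 ?stationary_weight_gt0//.
rewrite lnV ?posrE ?mean_cycle_gt0//.
have /andP[] := stationary_weight_bounds (x 0%N) 1 (mkseq (shift_map x) n).
rewrite -ler_ln ?posrE ?stationary_weight_gt0 ?renewal_weight_gt0// => s1.
rewrite -ler_ln ?posrE ?stationary_weight_gt0 ?mulr_gt0 ?renewal_weight_gt0//.
rewrite lnM ?posrE ?renewal_weight_gt0// => s2.
set S := ln (stationary_weight _ _ _) in s1 s2 *.
set F := ln (renewal_weight _ _ _) in s1 s2 *.
have := ler_norm (ln mean_cycle); have := ler_norm (- ln mean_cycle).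
have := ler_norm (kappa false); have := ler_norm (- kappa false).
have := normr_ge0 (kappa false).
rewrite !normrN !ler_norml => n1 n2 n3 n4 n5 /andP[].
by case: (x 0%N) => h1 h2; apply/andP; split; lra.
Qed.

End gibbs_property.
End alternating_renewal.

(** * Tails of geometrically decaying series *)

Section tails.
Context {R : realType}.
Implicit Types (u v : nat -> R) (x y : R).

Definition tail_partial_sum u n : nat -> R := fun N => \sum_(j < N) u (n + j)%N.

Definition tail_sum u n : R := limn (tail_partial_sum u n).

Definition geometric_decay x u := forall n, 0 < u n /\ u n.+1 <= x * u n.

(** The correction term [u (n + N) / (1 - x)] makes the left-hand side
    nonincreasing in [N]. *)
Lemma tail_partial_sum_le x u n N : 0 < x < 1 -> geometric_decay x u ->
  tail_partial_sum u n N + u (n + N)%N / (1 - x) <= u n / (1 - x).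
Proof.
move=> /andP[x0 x1] gu; elim: N => [|N].
  by rewrite /tail_partial_sum big_ord0 add0r addn0.
apply: le_trans; rewrite /tail_partial_sum big_ord_recr /= -addrA lerD2l addnS.
have [_ h] := gu (n + N)%N.
have -> : u (n + N)%N / (1 - x) = u (n + N)%N + x * u (n + N)%N / (1 - x).
  by field; rewrite subr_eq0 gt_eqF.
by rewrite lerD2l ler_pM2r// invr_gt0 subr_gt0.
Qed.

Lemma nondecreasing_tail_partial_sum u n : (forall k, 0 <= u k) ->
  {homo tail_partial_sum u n : i j / (i <= j)%N >-> i <= j}.
Proof.
move=> u0 i j ij; rewrite /tail_partial_sum -(subnKC ij) big_split_ord /= lerDl.
by apply: sumr_ge0 => k _.
Qed.

Lemma is_cvg_tail x u n : 0 < x < 1 -> geometric_decay x u ->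
  cvgn (tail_partial_sum u n).
Proof.
move=> x01 gu; apply: nondecreasing_is_cvgn.
  by apply: nondecreasing_tail_partial_sum => k; apply/ltW; exact: (gu k).1.
exists (u n / (1 - x)) => _ [N _ <-].
apply: le_trans (tail_partial_sum_le n N x01 gu); rewrite lerDl.
have /andP[x0 x1] := x01.
by rewrite divr_ge0 ?subr_ge0 ?ltW//; exact: (gu _).1.
Qed.

Arguments is_cvg_tail {x u} n _ _.

Lemma tail_sum_ge x u n N : 0 < x < 1 -> geometric_decay x u ->
  tail_partial_sum u n N <= tail_sum u n.
Proof.
move=> x01 gu; apply: nondecreasing_cvgn_le; last exact: is_cvg_tail gu.
by apply: nondecreasing_tail_partial_sum => k; apply/ltW; exact: (gu k).1.
Qed.

Lemma tail_sum_le x u n : 0 < x < 1 -> geometric_decay x u ->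
  tail_sum u n <= u n / (1 - x).
Proof.
move=> x01 gu; apply: limr_le; first exact: is_cvg_tail gu.
near=> N; apply: le_trans (tail_partial_sum_le n N x01 gu); rewrite lerDl.
have /andP[x0 x1] := x01.
by rewrite divr_ge0 ?subr_ge0 ?ltW//; exact: (gu _).1.
Unshelve. all: by end_near.
Qed.

Lemma tail_sum_mono u v n :
  cvgn (tail_partial_sum u n) -> cvgn (tail_partial_sum v n) ->
  (forall k, (n <= k)%N -> u k <= v k) -> tail_sum u n <= tail_sum v n.
Proof.
move=> cu cv uv; apply: ler_lim => //; near=> N.
by apply: ler_sum => j _; apply: uv; exact: leq_addr.
Unshelve. all: by end_near.
Qed.

Lemma tail_sumD u v n :
  cvgn (tail_partial_sum u n) -> cvgn (tail_partial_sum v n) ->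
  tail_sum (fun k => u k + v k) n = tail_sum u n + tail_sum v n.
Proof.
move=> cu cv; apply/cvg_lim => //.
rewrite (_ : tail_partial_sum _ n = tail_partial_sum u n + tail_partial_sum v n).
  exact: cvgD cu cv.
by apply/funext => N; rewrite /tail_partial_sum big_split.
Qed.

Lemma tail_sum_rec x u n : 0 < x < 1 -> geometric_decay x u ->
  tail_sum u n = u n + tail_sum u n.+1.
Proof.
move=> x01 gu; have := is_cvg_tail n x01 gu; rewrite /tail_sum => cu.
have cu' := is_cvg_tail n.+1 x01 gu.
apply/cvg_lim => //; rewrite -cvg_shiftS.
have -> : (fun N => tail_partial_sum u n N.+1) =
    (fun N => u n + tail_partial_sum u n.+1 N).
  apply/funext => N; rewrite /tail_partial_sum big_ord_recl addn0; congr (_ + _).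
  by apply: eq_bigr => j _; rewrite /= /bump add1n addnS.
by apply: cvgD => //; exact: cvg_cst.
Qed.

Lemma tail_sum_split x u n N : 0 < x < 1 -> geometric_decay x u ->
  tail_sum u n = tail_partial_sum u n N + tail_sum u (n + N)%N.
Proof.
move=> x01 gu; elim: N => [|N ->].
  by rewrite /tail_partial_sum big_ord0 add0r addn0.
rewrite (tail_sum_rec _ x01 gu) addnS /tail_partial_sum big_ord_recr /=.
by rewrite addrA.
Qed.

Lemma tail_sum_geometric_decay x u : 0 < x < 1 -> geometric_decay x u ->
  geometric_decay x (tail_sum u).
Proof.
move=> x01 gu n; split.
  rewrite (tail_sum_rec _ x01 gu) ltr_wpDr ?(gu n).1//.
  apply: le_trans (tail_sum_ge n.+1 0 x01 gu).
  by rewrite /tail_partial_sum big_ord0.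
have cu := is_cvg_tail n x01 gu.
have cxu : x * tail_partial_sum u n N @[N --> \oo] --> x * tail_sum u n.
  by apply: cvgM => //; exact: cvg_cst.
rewrite -[leRHS](cvg_lim _ cxu)//.
apply: ler_lim; [exact: is_cvg_tail gu|exact: cvgP cxu|].
near=> N; rewrite /tail_partial_sum /= mulr_sumr; apply: ler_sum => j _.
by rewrite addSn; exact: (gu _).2.
Unshelve. all: by end_near.
Qed.

Lemma geometric_decay_expr x c : 0 < x -> 0 < c -> geometric_decay x (fun n => c * x ^+ n).
Proof.
move=> x0 c0 n; split; first by rewrite mulr_gt0// exprn_gt0.
by rewrite exprS; rewrite le_eqVlt; apply/orP; left; apply/eqP; ring.
Qed.

Lemma tail_sum_expr x c n : 0 < x < 1 -> 
  tail_sum (fun k => c * x ^+ k) n = c * x ^+ n / (1 - x).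
Proof.
move=> /andP[x0 x1]; apply/cvg_lim => //.
have -> : tail_partial_sum (fun k => c * x ^+ k) n = series (geometric (c * x ^+ n) x).
  apply/funext => N; rewrite /tail_partial_sum /series /= big_mkord.
  by apply: eq_bigr => j _; rewrite exprD mulrA.
by apply: cvg_geometric_series; rewrite gtr0_norm.
Qed.

Lemma tail_sum_le_split x u n N : 0 < x < 1 -> geometric_decay x u ->
  tail_sum u n <= N%:R * u n + u (n + N)%N / (1 - x).
Proof.
move=> x01 gu; rewrite (tail_sum_split n N x01 gu); apply: lerD; last exact: tail_sum_le gu.
have /andP[x0 x1] := x01.
rewrite /tail_partial_sum mulr_natl -[X in _ *+ X](card_ord N) -sumr_const.
apply: ler_sum => j _; elim: (j : nat) => [|k IH]; first by rewrite addn0.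
rewrite addnS; apply: le_trans (gu _).2 _; apply: le_trans IH.
by rewrite ler_piMl ?ltW//; exact: (gu _).1.
Qed.

(** The product of the two series is at most 1/4 at [x = 1/3] and at least 1 at
    [x = 1 / (1 + delta)]. For continuity, the coefficients lie in [0, 1], so that
    between two points each series increases by at most as much as
    [x + x^2 + ... = x / (1 - x)]. *)
Lemma pressure_equation (c c' : nat -> R) (delta : R) : 0 < delta ->
  (forall n, delta <= c n <= 1) -> (forall n, delta <= c' n <= 1) ->
  (forall n, c n.+1 <= c n) -> (forall n, c' n.+1 <= c' n) ->
  exists x, 0 < x < 1 /\
    tail_sum (fun n => c n * x ^+ n) 1 * tail_sum (fun n => c' n * x ^+ n) 1 = 1.
Proof.
move=> d0 c01 c01' cdec cdec'.
have geo (e : nat -> R) x y : (forall n, delta <= e n <= 1) -> (forall n, e n.+1 <= e n) ->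
    0 < x -> x <= y -> geometric_decay y (fun n => e n * x ^+ n).
  move=> e01 edec x0 xy n; have /andP[h1 h2] := e01 n.
  have en : 0 < e n by exact: lt_le_trans h1.
  have xn : 0 < x ^+ n by exact: exprn_gt0.
  split; first by rewrite mulr_gt0.
  rewrite exprS mulrCA; apply: ler_pM => //.
  - exact: ltW.
  - rewrite mulr_ge0// ltW//.
    by have /andP[h _] := e01 n.+1; exact: lt_le_trans h.
  - by rewrite ler_pM2r.
pose kap e x := tail_sum (fun n => e n * x ^+ n) 1.
pose psi (x : R) := x / (1 - x).
have psiE x : 0 < x < 1 -> tail_sum (fun n => 1 * x ^+ n) 1 = psi x.
  by move=> x01; rewrite tail_sum_expr// expr1 mul1r.
have bounds (e : nat -> R) x : (forall n, delta <= e n <= 1) -> (forall n, e n.+1 <= e n) ->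
    0 < x < 1 -> delta * psi x <= kap e x <= psi x.
  move=> e01 edec x01; have /andP[x0 x1] := x01.
  have ce := is_cvg_tail 1 x01 (geo _ _ _ e01 edec x0 (lexx x)).
  have c1 d : 0 < d -> cvgn (tail_partial_sum (fun n => d * x ^+ n) 1).
    by move=> ?; apply: (is_cvg_tail 1 x01); exact: geometric_decay_expr.
  apply/andP; split.
    have -> : delta * psi x = tail_sum (fun n => delta * x ^+ n) 1.
      by rewrite tail_sum_expr// expr1 mulrA.
    apply: tail_sum_mono => //; first exact: c1.
    move=> k _; rewrite ler_pM2r ?exprn_gt0//.
    by have /andP[] := e01 k.
  rewrite -psiE//; apply: tail_sum_mono => //; first exact: c1.
  move=> k _; rewrite ler_pM2r ?exprn_gt0//.
  by have /andP[] := e01 k.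
have lip (e : nat -> R) x y : (forall n, delta <= e n <= 1) -> (forall n, e n.+1 <= e n) ->
    0 < x -> x <= y -> y < 1 -> 0 <= kap e y - kap e x <= psi y - psi x.
  move=> e01 edec x0 xy y1; have y0 := lt_le_trans x0 xy.
  have y01 : 0 < y < 1 by rewrite y0.
  have x01 : 0 < x < 1 by rewrite x0 (le_lt_trans xy).
  have cx := is_cvg_tail 1 x01 (geo _ _ _ e01 edec x0 (lexx x)).
  have cy := is_cvg_tail 1 y01 (geo _ _ _ e01 edec y0 (lexx y)).
  have c1x := is_cvg_tail 1 x01 (geometric_decay_expr x0 ltr01).
  have c1y := is_cvg_tail 1 y01 (geometric_decay_expr y0 ltr01).
  have xyn n : x ^+ n <= y ^+ n by apply: lerXn2r; rewrite ?nnegrE// ltW.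
  have edelta n : 0 <= e n by have /andP[h _] := e01 n; apply: le_trans h; exact: ltW.
  apply/andP; split.
    rewrite subr_ge0; apply: tail_sum_mono => // k _.
    by rewrite ler_wpM2l.
  rewrite lerBrDr addrAC lerBlDr.
  rewrite -(psiE x)// -(psiE y)// /kap -!tail_sumD//.
  have cD u v : cvgn (tail_partial_sum u 1) -> cvgn (tail_partial_sum v 1) ->
      cvgn (tail_partial_sum (fun n => u n + v n) 1).
    move=> cu cv; rewrite (_ : tail_partial_sum _ _ =
      (fun N => tail_partial_sum u 1 N + tail_partial_sum v 1 N)).
      exact: is_cvgD.
    by apply/funext => N; rewrite /tail_partial_sum big_split.
  apply: tail_sum_mono; [exact: cD|exact: cD|] => k _.
  have := xyn k; have /andP[_ e1] := e01 k.
  have : 0 <= (1 - e k) * (y ^+ k - x ^+ k) by rewrite mulr_ge0 ?subr_ge0.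
  lra.
have cont (e : nat -> R) x : (forall n, delta <= e n <= 1) -> (forall n, e n.+1 <= e n) ->
    0 < x < 1 -> {for x, continuous (kap e)}.
  move=> e01 edec x01; have /andP[x0 x1] := x01.
  have cpsi : {for x, continuous psi}.
    apply: cvgM; first exact: cvg_id.
    apply: cvgV; first by rewrite subr_eq0 gt_eqF.
    by apply: cvgB; [exact: cvg_cst|exact: cvg_id].
  apply/cvgrPdist_le => eps eps0.
  have /cvgrPdist_le /(_ _ eps0) np := cpsi.
  near=> y.
  have yx : 0 < y < 1.
    have xI : x \in `]0, 1[ by rewrite in_itv.
    suff : y \in `]0, 1[ by rewrite in_itv.
    by near: y; exact: near_in_itvoo.
  have hy : `|psi x - psi y| <= eps by near: y.
  apply: le_trans hy; have /andP[y0 y1] := yx.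
  have [xy|/ltW xy] := leP x y.
    have /andP[h1 h2] := lip e x y e01 edec x0 xy y1.
    rewrite distrC [leRHS]distrC ger0_norm// ger0_norm//.
    exact: le_trans h2.
  have /andP[h1 h2] := lip e y x e01 edec y0 xy x1.
  rewrite ger0_norm// ger0_norm//.
  exact: le_trans h2.
have d1 : delta <= 1 by have /andP[h1 h2] := c01 0%N; exact: le_trans h2.
pose x2 := (1 + delta)^-1.
have x2gt : 3^-1 <= x2 by rewrite lef_pV2 ?posrE; lra.
have x201 : 0 < x2 < 1 by rewrite invr_gt0 invf_lt1; lra.
have t01 : 0 < (3^-1 : R) < 1 by lra.
have [|||x xI xE] := @IVT R (fun x => kap c x * kap c' x) 3^-1 x2 1 => //.
- apply: continuous_in_subspaceT => y; rewrite inE /= in_itv /= => /andP[y1 y2].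
  have y01 : 0 < y < 1 by apply/andP; split; [lra|case/andP: x201 => _; exact: le_lt_trans].
  by apply: cvgM; exact: cont.
- have /andP[a1 a2] := bounds c 3^-1 c01 cdec t01.
  have /andP[b1 b2] := bounds c' 3^-1 c01' cdec' t01.
  have /andP[e1 e2] := bounds c x2 c01 cdec x201.
  have /andP[f1 f2] := bounds c' x2 c01' cdec' x201.
  have p3 : psi 3^-1 = 2^-1 by rewrite /psi; field.
  have p2 : delta * psi x2 = 1.
    by rewrite /psi /x2; field; apply/andP; split; lra.
  rewrite p3 in a1 a2 b1 b2; rewrite p2 in e1 f1.
  apply/andP; split; rewrite ?ge_min ?le_max; apply/orP; [left|right].
    have : kap c 3^-1 * kap c' 3^-1 <= 2^-1 * 2^-1.
      apply: ler_pM => //; [apply: le_trans a1|apply: le_trans b1]; lra.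
    lra.
  have : 1 * 1 <= kap c x2 * kap c' x2 by apply: ler_pM.
  lra.
exists x; split => //; move: xI; rewrite in_itv /= => /andP[h1 h2].
by apply/andP; split; [lra|case/andP: x201 => _; exact: le_lt_trans].
Unshelve. all: by end_near.
Qed.

End tails.

Arguments is_cvg_tail {R x u} n _ _.

(** * The equilibrium measure of a potential depending on the first run *)

Lemma tail_sumZ (R : realType) (k : R) (u : nat -> R) n :
  cvgn (tail_partial_sum u n) ->
  tail_sum (fun i => k * u i) n = k * tail_sum u n.
Proof.
move=> cu; apply/cvg_lim => //.
rewrite (_ : tail_partial_sum _ n = (fun N => k * tail_partial_sum u n N)).
  by apply: cvgM => //; exact: cvg_cst.
by apply/funext => N; rewrite /tail_partial_sum mulr_sumr.
Qed.

Lemma measurable_lipschitz (R : realType) (theta : R) (f : binseq -> R) :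
  0 < theta < 1 -> dtheta_lipschitz theta f -> measurable_fun [set: binseq] f.
Proof.
move=> t01 [K hK].
have K0 : 0 < `|K| + 1 by rewrite ltr_wpDl.
have fopen y : open (f @^-1` `]y, +oo[).
  rewrite openE => x /=; rewrite in_itv /= andbT => yx.
  apply/(nbhs_dtheta x _ t01); exists ((f x - y) / (`|K| + 1)).
    by rewrite divr_gt0// subr_gt0.
  move=> z; rewrite ltr_pdivlMr//= => xz; rewrite in_itv /= andbT.
  have d0 : 0 <= dtheta theta x z.
    rewrite /dtheta; case: pselect => // h; rewrite exprn_ge0//.
    by case/andP: t01 => /ltW.
  have := le_trans (ler_norm _) (hK x z).
  have : K * dtheta theta x z <= (`|K| + 1) * dtheta theta x z.
    by rewrite ler_wpM2r// ler_wpDr// ler_norm.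
  lra.
apply: (measurability _ (RGenOInfty.measurableE R)) => _ [_ [y ->] <-].
by rewrite setTI; apply: sub_sigma_algebra; exact: fopen.
Qed.

Lemma binseq_run_cases (x : binseq) :
  (exists s, x = fun=> s) \/
  exists s n, (0 < n)%N /\ cylinder (rcons (nseq n s) (~~ s)) x.
Proof.
have [cst|ncst] := pselect (forall i, x i = x 0%N).
  by left; exists (x 0%N); apply/funext => i; rewrite cst.
right; have ex : exists i, x i != x 0%N.
  apply: contrapT => h; apply: ncst => i; apply/eqP/negPn/negP => h2.
  by apply: h; exists i.
have [n xn nmin] := ex_minnP ex.
exists (x 0%N), n; split; first by case: n xn {nmin} => //; rewrite eqxx.
move=> i; rewrite size_rcons size_nseq ltnS leq_eqVlt nth_rcons size_nseq.
case/predU1P => [->|ni].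
  by rewrite ltnn eqxx; case: (x n) (x 0%N) xn => -[].
by rewrite ni nth_nseq ni; apply/eqP/negPn/negP => /nmin; rewrite leqNgt ni.
Qed.

Lemma mkseq_const (s : bool) n : mkseq (fun=> s) n = nseq n s.
Proof.
by apply: (@eq_from_nth _ false); rewrite size_mkseq ?size_nseq// => i ni;
  rewrite nth_mkseq// nth_nseq ni.
Qed.

Lemma mkseq_run (x : binseq) s q n : cylinder (rcons (nseq q s) (~~ s)) x -> (q < n)%N ->
  mkseq x n = nseq q s ++ ~~ s :: mkseq (iter q.+1 shift_map x) (n - q.+1).
Proof.
elim: q x n => [|q IH] x [//|n] xq; rewrite mkseq_shift ltnS => qn.
  by rewrite (xq 0%N isT) subn1.
rewrite (xq 0%N isT) /= (IH _ n)// => [|i iq]; last exact: (xq i.+1).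
by rewrite -iterSr subSS.
Qed.

Lemma cylinder_cons (s : bool) w (x : binseq) :
  x 0%N = s -> cylinder w (shift_map x) -> cylinder (s :: w) x.
Proof. by move=> x0 xw [|i] //= iw; exact: xw. Qed.

Section run_potential.
Context {R : realType}.
Variable G : bool -> nat -> R.
Implicit Types (beta x : R).

(** [G s n] is the sum of the potential over a run of [n] symbols [s], and [- ln x]
    plays the part of the pressure at inverse temperature [beta]. The run-length
    laws are normalized by [run_norm]; the pressure equation states that the two
    norms have product 1. *)
Definition run_weight beta x s n := expR (beta * G s n) * x ^+ n.
Definition run_norm beta x s := tail_sum (run_weight beta x s) 1.
Definition run_law beta x s n := (run_norm beta x s)^-1 * run_weight beta x s n.
Definition run_survival beta x s := tail_sum (run_law beta x s).
Definition run_survival_sum beta x s := tail_sum (run_survival beta x s).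

Definition run_cylinder_mass beta x : seq bool -> R :=
  cylinder_mass (run_law beta x) (run_survival beta x) (run_survival_sum beta x).

Hypothesis G_dec : forall s n, G s n.+1 <= G s n.
Hypothesis G0 : forall s, G s 0 = 0.

Lemma run_weight_geometric beta x s : 0 < beta -> 0 < x < 1 ->
  geometric_decay x (run_weight beta x s).
Proof.
move=> b0 /andP[x0 x1] n; rewrite /run_weight; split.
  by rewrite mulr_gt0 ?expR_gt0 ?exprn_gt0.
by rewrite exprS mulrCA ler_pM2l// ler_pM2r ?exprn_gt0// ler_expR ler_pM2l.
Qed.

Lemma run_norm_gt0 beta x s : 0 < beta -> 0 < x < 1 -> 0 < run_norm beta x s.
Proof.
move=> b0 x01; have gu := run_weight_geometric s b0 x01.
exact: (tail_sum_geometric_decay x01 gu 1%N).1.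
Qed.

Lemma run_law_geometric beta x s : 0 < beta -> 0 < x < 1 ->
  geometric_decay x (run_law beta x s).
Proof.
move=> b0 x01 n; have [h1 h2] := run_weight_geometric s b0 x01 n.
have k0 := run_norm_gt0 s b0 x01.
rewrite /run_law; split; first by rewrite mulr_gt0 ?invr_gt0.
by rewrite [leRHS]mulrCA ler_pM2l ?invr_gt0.
Qed.

Lemma run_survival_geometric beta x s : 0 < beta -> 0 < x < 1 ->
  geometric_decay x (run_survival beta x s).
Proof.
by move=> b0 x01; apply: tail_sum_geometric_decay => //; exact: run_law_geometric.
Qed.

Lemma run_survival_sum_gt0 beta x s n : 0 < beta -> 0 < x < 1 ->
  0 < run_survival_sum beta x s n.
Proof.
move=> b0 x01.
exact: (tail_sum_geometric_decay x01 (run_survival_geometric s b0 x01) n).1.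
Qed.

Lemma run_survivalE beta x s n : 0 < beta -> 0 < x < 1 ->
  run_survival beta x s n = (run_norm beta x s)^-1 * tail_sum (run_weight beta x s) n.
Proof.
move=> b0 x01; rewrite /run_survival /run_law tail_sumZ//.
exact: is_cvg_tail (run_weight_geometric s b0 x01).
Qed.

Lemma run_survival1 beta x s : 0 < beta -> 0 < x < 1 -> run_survival beta x s 1 = 1.
Proof.
move=> b0 x01; rewrite run_survivalE// mulVf// gt_eqF//; exact: run_norm_gt0.
Qed.

Lemma run_cylinder_mass_gt0 beta x w : 0 < beta -> 0 < x < 1 ->
  0 < run_cylinder_mass beta x w.
Proof.
move=> b0 x01; apply: cylinder_mass_gt0 => s n.
- exact: (run_law_geometric s b0 x01 n).1.
- exact: (run_survival_geometric s b0 x01 n).1.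
- exact: run_survival_sum_gt0.
Qed.

Lemma run_survival_rec beta x s n : 0 < beta -> 0 < x < 1 ->
  run_survival beta x s n = run_law beta x s n + run_survival beta x s n.+1.
Proof. by move=> b0 x01; apply: (tail_sum_rec n x01); exact: run_law_geometric. Qed.

Lemma run_survival_sum_rec beta x s n : 0 < beta -> 0 < x < 1 ->
  run_survival_sum beta x s n = run_survival beta x s n + run_survival_sum beta x s n.+1.
Proof. by move=> b0 x01; apply: (tail_sum_rec n x01); exact: run_survival_geometric. Qed.

Lemma run_cylinder_mass_rcons beta x w : 0 < beta -> 0 < x < 1 ->
  run_cylinder_mass beta x (rcons w false) + run_cylinder_mass beta x (rcons w true) =
  run_cylinder_mass beta x w.
Proof.
move=> b0 x01; apply: cylinder_mass_rcons => s *.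
- exact: run_survival_sum_gt0.
- exact: run_survival1.
- exact: run_survival_rec.
- exact: run_survival_sum_rec.
Qed.

Lemma run_cylinder_mass_cons beta x w : 0 < beta -> 0 < x < 1 ->
  run_cylinder_mass beta x (false :: w) + run_cylinder_mass beta x (true :: w) =
  run_cylinder_mass beta x w.
Proof.
move=> b0 x01; apply: cylinder_mass_cons => s *.
- exact: run_survival_sum_gt0.
- exact: run_survival1.
- exact: run_survival_rec.
- exact: run_survival_sum_rec.
Qed.

Variables (f : binseq -> R) (g : bool -> nat -> R) (D : R).
Hypothesis GE : forall s n, G s n = \sum_(1 <= j < n.+1) g s j.
Hypothesis g_le0 : forall s n, (0 < n)%N -> g s n <= 0.
Hypothesis G_ge : forall s n, - D <= G s n.
Hypothesis f_run : forall s n, (0 < n)%N ->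
  forall y, cylinder (rcons (nseq n s) (~~ s)) y -> f y = g s n.
Hypothesis f_const : forall s, f (fun=> s) = 0.
Hypothesis mf : measurable_fun [set: binseq] f.

Lemma run_potential_bounds y : - D <= f y <= 0.
Proof.
have D0 : 0 <= D by have := G_ge false 0; rewrite G0 oppr_le0.
have [[s ->]|[s [n [n0 yn]]]] := binseq_run_cases y.
  by rewrite f_const lexx oppr_le0 D0.
rewrite (f_run n0 yn) g_le0// andbT.
case: n n0 yn => // n _ _; have := G_ge s n.+1; rewrite GE big_nat_recr//= -GE.
have : G s n <= 0 by elim: n => [|n IH]; rewrite ?G0// (le_trans (G_dec _ _)).
lra.
Qed.

(** The renewal measure of the solution [x] of the pressure equation has the
    Gibbs property for [beta * f] and pressure [- ln x], hence attains the
    supremum; uniqueness identifies it with the given measure. *)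
Lemma equilibrium_run_cylinder_mass beta (m : probability binseq R) : 0 < beta ->
  is_equilibrium_measure (fun y => beta * f y) m ->
  exists x, [/\ 0 < x < 1, run_norm beta x false * run_norm beta x true = 1 &
    forall w, m (cylinder w) = (run_cylinder_mass beta x w)%:E].
Proof.
move=> b0 [_ muniq].
have Gle0 s n : G s n <= 0.
  by elim: n => [|n IH]; rewrite ?G0// (le_trans (G_dec _ _)).
have D0 : 0 <= D by have := G_ge false 0; rewrite G0 oppr_le0.
have c01 s n : expR (- (beta * D)) <= expR (beta * G s n) <= 1.
  by rewrite ler_expR -mulrN ler_pM2l// G_ge -expR0 ler_expR mulr_ge0_le0// ltW.
have cdec s n : expR (beta * G s n.+1) <= expR (beta * G s n).
  by rewrite ler_expR ler_pM2l.
have [x [x01 xE]] := pressure_equation (expR_gt0 _) (c01 false) (c01 true)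
  (cdec false) (cdec true).
have k0 s := run_norm_gt0 s b0 x01.
have /andP[x0 x1] := x01.
exists x; split => //.
have [nu [nuinv nuE]] := @renewal_probability R (run_law beta x) (run_survival beta x)
  (run_survival_sum beta x) (fun s n => (run_law_geometric s b0 x01 n).1)
  (fun s n => (run_survival_geometric s b0 x01 n).1)
  (fun s n => run_survival_sum_gt0 s n b0 x01) (fun s => run_survival1 s b0 x01)
  (fun s n => run_survival_rec s n b0 x01) (fun s n => run_survival_sum_rec s n b0 x01).
have massE w : mass nu (cylinder w) = run_cylinder_mass beta x w by rewrite /mass nuE.
move=> w; rewrite -(muniq nu); [exact: nuE| |exact: measurable_cylinder].
have p0 : 0 <= - ln x by rewrite oppr_ge0 ln_le0// ltW.
have K1 : 1 <= (1 - x)^-1 by rewrite invf_ge1; lra.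
pose g' s n := beta * g s n.
have GE' s n : \sum_(1 <= j < n.+1) g' s j = beta * G s n by rewrite GE mulr_sumr.
apply: (@gibbs_measure_attains_pressure R (fun y => beta * f y) (- ln x)).
- by apply: measurable_funM => //; exact: measurable_cst.
- exists (beta * D); split; first exact: num_real.
  move=> M hM y _ /=; apply: le_trans (ltW hM).
  rewrite normrM gtr0_norm// ler_pM2l// ler_norml.
  by have /andP[h1 h2] := run_potential_bounds y; rewrite h1 (le_trans h2).
- by move=> v; rewrite massE; exact: run_cylinder_mass_gt0.
- move=> n y; rewrite massE.
  apply: (@cylinder_mass_gibbs R (run_law beta x) (run_survival beta x)
    (run_survival_sum beta x) _ _ _ _ _ (fun y => beta * f y) g' (- ln x) (beta * D)
    (1 - x)^-1 (fun s => ln (run_norm beta x s))).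
  + by move=> s k; exact: (run_law_geometric s b0 x01 k).1.
  + by move=> s k; exact: (run_survival_geometric s b0 x01 k).1.
  + by move=> s k; exact: run_survival_sum_gt0.
  + by move=> s k; exact: run_survival_rec.
  + by move=> s k; exact: run_survival_sum_rec.
  + by move=> s k k1; rewrite /g' mulr_ge0_le0 ?g_le0// ltW.
  + by move=> s k; rewrite GE' -mulrN ler_pM2l.
  + by move=> s k k1 z zk; rewrite (f_run k1 zk).
  + move=> s z zs; rewrite (_ : z = fun=> s) ?f_const ?mulr0//.
    exact/funext.
  + move=> s k k1; rewrite GE' /run_law /run_weight.
    rewrite lnM ?posrE ?invr_gt0 ?mulr_gt0 ?expR_gt0 ?exprn_gt0//.
    rewrite lnM ?posrE ?expR_gt0 ?exprn_gt0// expRK lnV ?posrE// lnXn//.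
    by rewrite -mulr_natl; ring.
  + by rewrite -lnM ?posrE// -(ln1 R); congr ln.
  + exact: K1.
  + move=> s k; rewrite mulrC; apply: tail_sum_le => //; exact: run_law_geometric.
  + move=> s k; rewrite mulrC; apply: tail_sum_le => //; exact: run_survival_geometric.
- exact: nuinv.
- move=> y; apply: le_trans p0; have /andP[_ fy] := run_potential_bounds y.
  by rewrite mulr_ge0_le0// ltW.
Qed.

End run_potential.

(** * Exponential rates as beta tends to infinity *)

Section rates.
Context {R : realType}.
Implicit Types (X Y : R -> R) (r : R).

(** Lower and upper bounds for [beta^-1 * ln (X beta)] at infinity. Keeping them
    apart, and free of logarithms, lets sums and products be treated directly. *)
Definition rate_ge X r := forall eta, 0 < eta ->
  \forall beta \near +oo, expR (beta * (r - eta)) <= X beta.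
Definition rate_le X r := forall eta, 0 < eta ->
  \forall beta \near +oo, X beta <= expR (beta * (r + eta)).
Definition has_rate X r := rate_ge X r /\ rate_le X r.

Lemma near_pinfty_gt (r : R) : \forall beta \near +oo, r < beta.
Proof. by apply: nbhs_pinfty_gt; exact: num_real. Qed.

Lemma le_expR_near (c eta : R) : 0 < eta -> \forall beta \near +oo, c <= expR (beta * eta).
Proof.
move=> eta0; near=> beta; apply: le_trans (expR_ge1Dx _).
have : (c - 1) / eta < beta by near: beta; exact: near_pinfty_gt.
by rewrite ltr_pdivrMr// => /ltW; rewrite lerBlDl.
Unshelve. all: by end_near.
Qed.

Lemma rate_ge_mono X Y r : rate_ge X r ->
  (\forall beta \near +oo, X beta <= Y beta) -> rate_ge Y r.
Proof.
move=> hX XY eta eta0; near=> beta.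
by apply: (@le_trans _ _ (X beta)); near: beta; [exact: hX|exact: XY].
Unshelve. all: by end_near.
Qed.

Lemma rate_le_mono X Y r : rate_le Y r ->
  (\forall beta \near +oo, X beta <= Y beta) -> rate_le X r.
Proof.
move=> hY XY eta eta0; near=> beta.
by apply: (@le_trans _ _ (Y beta)); near: beta; [exact: XY|exact: hY].
Unshelve. all: by end_near.
Qed.

Lemma has_rate_expR r : has_rate (fun beta => expR (beta * r)) r.
Proof.
by split => eta eta0; near=> beta; rewrite ler_expR ler_pM2l; try lra;
  near: beta; exact: near_pinfty_gt.
Unshelve. all: by end_near.
Qed.

Lemma has_rate_cst (c : R) : 0 < c -> has_rate (fun=> c) 0.
Proof.
move=> c0; split => eta eta0; near=> beta.
  rewrite sub0r mulrN expRN invf_ple ?posrE ?expR_gt0//.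
  by near: beta; exact: le_expR_near.
by rewrite add0r; near: beta; exact: le_expR_near.
Unshelve. all: by end_near.
Qed.

Lemma rate_geM X Y r r' : rate_ge X r -> rate_ge Y r' ->
  rate_ge (fun beta => X beta * Y beta) (r + r').
Proof.
move=> hX hY eta eta0; have e2 : 0 < eta / 2 by rewrite divr_gt0.
near=> beta.
have -> : beta * (r + r' - eta) = beta * (r - eta / 2) + beta * (r' - eta / 2) by field.
rewrite expRD; apply: ler_pM; rewrite ?expR_ge0//; near: beta; [exact: hX|exact: hY].
Unshelve. all: by end_near.
Qed.

Lemma rate_leM X Y r r' :
  (\forall beta \near +oo, 0 <= X beta) -> (\forall beta \near +oo, 0 <= Y beta) ->
  rate_le X r -> rate_le Y r' ->
  rate_le (fun beta => X beta * Y beta) (r + r').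
Proof.
move=> X0 Y0 hX hY eta eta0; have e2 : 0 < eta / 2 by rewrite divr_gt0.
near=> beta.
have -> : beta * (r + r' + eta) = beta * (r + eta / 2) + beta * (r' + eta / 2) by field.
rewrite expRD; apply: ler_pM; near: beta; [exact: X0|exact: Y0|exact: hX|exact: hY].
Unshelve. all: by end_near.
Qed.

Lemma has_rate_gt0 X r : has_rate X r -> \forall beta \near +oo, 0 < X beta.
Proof.
move=> [hX _]; near=> beta; apply: lt_le_trans (expR_gt0 (beta * (r - 1))) _.
by near: beta; exact: hX.
Unshelve. all: by end_near.
Qed.

Lemma has_rateM X Y r r' : has_rate X r -> has_rate Y r' ->
  has_rate (fun beta => X beta * Y beta) (r + r').
Proof.
move=> hX hY; split; first by apply: rate_geM; [exact: hX.1|exact: hY.1].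
apply: rate_leM; [| |exact: hX.2|exact: hY.2].
  by apply: filterS (has_rate_gt0 hX) => beta /ltW.
by apply: filterS (has_rate_gt0 hY) => beta /ltW.
Qed.

Lemma has_rateV X r : has_rate X r -> has_rate (fun beta => (X beta)^-1) (- r).
Proof.
move=> hX; have X0 := has_rate_gt0 hX; split => eta eta0; near=> beta.
  have -> : beta * (- r - eta) = - (beta * (r + eta)) by ring.
  rewrite expRN lef_pV2 ?posrE ?expR_gt0//; near: beta; [exact: hX.2|exact: X0].
have -> : beta * (- r + eta) = - (beta * (r - eta)) by ring.
rewrite expRN lef_pV2 ?posrE ?expR_gt0//; near: beta; [exact: hX.1|exact: X0].
Unshelve. all: by end_near.
Qed.

Lemma rate_le_weaken X r r' : r <= r' -> rate_le X r -> rate_le X r'.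
Proof.
move=> rr hX eta eta0; near=> beta.
have b0 : 0 < beta by near: beta; exact: near_pinfty_gt.
apply: (@le_trans _ _ (expR (beta * (r + eta)))); first by near: beta; exact: hX.
by rewrite ler_expR ler_pM2l// lerD2r.
Unshelve. all: by end_near.
Qed.

Lemma rate_leD X Y r : rate_le X r -> rate_le Y r ->
  rate_le (fun beta => X beta + Y beta) r.
Proof.
move=> hX hY eta eta0; have e2 : 0 < eta / 2 by rewrite divr_gt0.
near=> beta.
apply: (@le_trans _ _ (2 * expR (beta * (r + eta / 2)))).
  rewrite mulrDl mul1r; apply: lerD; near: beta; [exact: hX|exact: hY].
have -> : beta * (r + eta) = beta * (eta / 2) + beta * (r + eta / 2) by field.
rewrite expRD ler_pM2r ?expR_gt0//.
by near: beta; exact: le_expR_near.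
Unshelve. all: by end_near.
Qed.

Lemma has_rateD X Y r r' : has_rate X r -> has_rate Y r' ->
  has_rate (fun beta => X beta + Y beta) (Num.max r r').
Proof.
move=> hX hY; have X0 := has_rate_gt0 hX; have Y0 := has_rate_gt0 hY; split.
  have [_|_] := leP r r'.
    apply: rate_ge_mono hY.1 _; near=> beta; rewrite lerDr ltW//.
    by near: beta; exact: X0.
  apply: rate_ge_mono hX.1 _; near=> beta; rewrite lerDl ltW//.
  by near: beta; exact: Y0.
by apply: rate_leD; [apply: rate_le_weaken hX.2|apply: rate_le_weaken hY.2];
  rewrite le_max lexx ?orbT.
Unshelve. all: by end_near.
Qed.

Lemma rate_ge_max X r r' : rate_ge X r -> rate_ge X r' -> rate_ge X (Num.max r r').
Proof. by move=> h h'; case: leP. Qed.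

Lemma rate_le_limit X r : (forall e, 0 < e -> rate_le X (r + e)) -> rate_le X r.
Proof.
move=> hX eta eta0; have e2 : 0 < eta / 2 by rewrite divr_gt0.
have := hX _ e2 _ e2; rewrite -addrA -splitr; exact.
Qed.

Lemma rate_ge_le X Y r r' : rate_ge X r -> rate_le Y r' ->
  (\forall beta \near +oo, X beta <= Y beta) -> r <= r'.
Proof.
move=> hX hY XY; apply/ler_addgt0Pr => e e0; have e2 : 0 < e / 2 by rewrite divr_gt0.
have [beta [b0 h]] : exists beta : R, 0 < beta /\
    expR (beta * (r - e / 2)) <= expR (beta * (r' + e / 2)).
  near (pinfty_nbhs R) => beta; exists beta; split.
    by near: beta; exact: near_pinfty_gt.
  apply: (@le_trans _ _ (X beta)); first by near: beta; exact: hX.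
  apply: (@le_trans _ _ (Y beta)); first by near: beta; exact: XY.
  by near: beta; exact: hY.
by move: h; rewrite ler_expR ler_pM2l//; lra.
Unshelve. all: by end_near.
Qed.

Lemma has_rate_unique X r r' : has_rate X r -> has_rate X r' -> r = r'.
Proof.
move=> h h'; apply/le_anti/andP.
by split; [apply: rate_ge_le h.1 h'.2 _|apply: rate_ge_le h'.1 h.2 _]; near=> beta.
Unshelve. all: by end_near.
Qed.

Lemma has_rate_near X Y r : (\forall beta \near +oo, X beta = Y beta) ->
  has_rate X r -> has_rate Y r.
Proof.
move=> XY hX; split.
  by apply: rate_ge_mono hX.1 _; apply: filterS XY => beta ->.
by apply: rate_le_mono hX.2 _; apply: filterS XY => beta ->.
Qed.

Lemma has_rate_cvg X r : has_rate X r -> beta^-1 * ln (X beta) @[beta --> +oo] --> r.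
Proof.
move=> hX; apply/cvgrPdist_le => e e0; near=> beta.
have b0 : 0 < beta by near: beta; exact: near_pinfty_gt.
have X0 : 0 < X beta by near: beta; exact: has_rate_gt0 hX.
have h1 : expR (beta * (r - e)) <= X beta by near: beta; exact: hX.1.
have h2 : X beta <= expR (beta * (r + e)) by near: beta; exact: hX.2.
move: h1 h2; rewrite -ler_ln ?posrE ?expR_gt0// expRK => h1.
rewrite -ler_ln ?posrE ?expR_gt0// expRK => h2.
have e1 : r - e <= beta^-1 * ln (X beta) by rewrite mulrC ler_pdivlMr// mulrC.
have e2 : beta^-1 * ln (X beta) <= r + e by rewrite mulrC ler_pdivrMr// mulrC.
by rewrite ler_norml; apply/andP; split; lra.
Unshelve. all: by end_near.
Qed.

End rates.

(** * Rates of the cylinder masses *)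

Section run_rates.
Context {R : realType}.
Variables (G : bool -> nat -> R) (L : bool -> R).
Hypothesis G_dec : forall s n, G s n.+1 <= G s n.
Hypothesis G0 : forall s, G s 0 = 0.
Hypothesis G_ge : forall s n, L s <= G s n.
Hypothesis G_lim : forall s e, 0 < e -> exists N, G s N <= L s + e.
Variables b d K : R.
Hypothesis bE : G false 1 = b.
Hypothesis dE : G true 1 = d.
Hypothesis KE : K = b + L true.
Hypothesis b_lt0 : b < 0.
Hypothesis d_lt0 : d < 0.
Hypothesis gap : L false < b + K.

Variable x : R -> R.
Hypothesis x01 : forall beta, 0 < beta -> 0 < x beta < 1.
Hypothesis x_norm : forall beta, 0 < beta ->
  run_norm G beta (x beta) false * run_norm G beta (x beta) true = 1.

Let u s n beta := run_weight G beta (x beta) s n.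
Let eps beta := 1 - x beta.

Let Gmono s k n : (k <= n)%N -> G s n <= G s k.
Proof.
move=> kn; rewrite -(subnKC kn); elim: (n - k)%N => [|j IH]; first by rewrite addn0.
by rewrite addnS (le_trans (G_dec _ _)).
Qed.

Let K_lt0 : K < 0.
Proof. by have := G_ge true 1; have := b_lt0; have := d_lt0; rewrite dE KE; lra. Qed.

Let u_geo s beta : 0 < beta -> geometric_decay (x beta) (fun n => u s n beta).
Proof. by move=> b0; apply: run_weight_geometric => //; exact: x01. Qed.

Let u_le s n beta : 0 < beta -> u s n beta <= expR (beta * G s n).
Proof.
move=> b0; have /andP[x0 x1] := x01 b0.
rewrite /u /run_weight ler_piMr ?expR_ge0// exprn_ile1// ltW//.
Qed.

Let tail_u_ge s n beta : 0 < beta ->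
  expR (beta * L s) * x beta ^+ n / eps beta <= tail_sum (fun k => u s k beta) n.
Proof.
move=> b0; rewrite -tail_sum_expr ?x01//; apply: tail_sum_mono.
- refine (is_cvg_tail n (x01 b0) (geometric_decay_expr _ (expR_gt0 _))).
  by have /andP[] := x01 b0.
- exact: is_cvg_tail n (x01 b0) (u_geo s b0).
move=> k _; have /andP[x0 _] := x01 b0.
by rewrite /u /run_weight ler_pM2r ?exprn_gt0// ler_expR ler_pM2l.
Qed.

(** Otherwise each of the two norms would be at most twice its first term, and
    their product would be exponentially small instead of 1. *)
Lemma x_ge_half : \forall beta \near +oo, 2^-1 <= x beta.
Proof.
have bd : 0 < - (G false 1 + G true 1) by
  rewrite oppr_gt0 bE dE; have := b_lt0; have := d_lt0; lra.
near=> beta.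
have b0 : 0 < beta by near: beta; exact: near_pinfty_gt.
have /andP[x0 x1] := x01 b0.
rewrite leNgt; apply/negP => xlt.
have ub s : run_norm G beta (x beta) s <= 2 * expR (beta * G s 1).
  apply: (le_trans (tail_sum_le 1 (x01 b0) (u_geo s b0))).
  have e2 : (1 - x beta)^-1 <= 2 by rewrite invf_ple ?posrE; lra.
  rewrite mulrC; apply: ler_pM => //; first by rewrite invr_ge0; lra.
    exact/ltW/(u_geo s b0 1%N).1.
  exact: u_le.
have : 1 <= (2 * expR (beta * G false 1)) * (2 * expR (beta * G true 1)).
  rewrite -[leLHS](x_norm b0).
  by apply: ler_pM => //; apply: ltW; apply: run_norm_gt0 => //; exact: x01.
rewrite mulrACA -expRD -mulrDr leNgt => /negP; apply.
have : 5 <= expR (beta * - (G false 1 + G true 1)) by near: beta; exact: le_expR_near.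
rewrite mulrN expRN => h; rewrite -[X in X * _]invrK -ltr_pdivlMl ?invrK ?invr_gt0//.
rewrite mulr1 -[ltLHS]invrK ltf_pV2 ?posrE ?invr_gt0 ?expR_gt0//.
by apply: lt_le_trans h; lra.
Unshelve. all: by end_near.
Qed.

Lemma has_rate_xn n : has_rate (fun beta => x beta ^+ n) 0.
Proof.
have h2 : 0 < 2^-1 ^+ n :> R by rewrite exprn_gt0.
split.
  apply: rate_ge_mono (has_rate_cst h2).1 _; near=> beta.
  apply: lerXn2r; rewrite ?nnegrE//.
    have b0 : 0 < beta by near: beta; exact: near_pinfty_gt.
    by have /andP[/ltW] := x01 b0.
  by near: beta; exact: x_ge_half.
apply: rate_le_mono (has_rate_cst ltr01).2 _; near=> beta.
have b0 : 0 < beta by near: beta; exact: near_pinfty_gt.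
by have /andP[/ltW x0 /ltW x1] := x01 b0; rewrite exprn_ile1.
Unshelve. all: by end_near.
Qed.

Lemma has_rate_u s n : has_rate (u s n) (G s n).
Proof.
have := has_rateM (has_rate_expR (G s n)) (has_rate_xn n).
by rewrite addr0.
Qed.

(** In [run_norm false * run_norm true = 1], the first term of the first series
    has rate [b], and the second series is at least [exp (beta * L true) * x / eps]. *)
Lemma rate_ge_eps : rate_ge eps K.
Proof.
have hr := has_rateM (has_rate_expR K) (has_rateM (has_rate_xn 1) (has_rate_xn 1)).
rewrite !addr0 in hr; apply: rate_ge_mono hr.1 _; near=> beta.
have b0 : 0 < beta by near: beta; exact: near_pinfty_gt.
have /andP[x0 x1] := x01 b0.
have e0 : 0 < eps beta by rewrite subr_gt0.
have h0 : expR (beta * b) * x beta ^+ 1 <= run_norm G beta (x beta) false.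
  have := tail_sum_ge 1 1 (x01 b0) (u_geo false b0).
  by rewrite /tail_partial_sum big_ord1 /u /run_weight addn0 bE.
have h1 := tail_u_ge true 1 b0.
have : (expR (beta * b) * x beta ^+ 1) *
    (expR (beta * L true) * x beta ^+ 1 / eps beta) <= 1.
  rewrite -(x_norm b0); apply: ler_pM => //.
  - by rewrite mulr_ge0 ?expR_ge0 ?exprn_ge0// ltW.
  - by rewrite divr_ge0 ?ltW// mulr_gt0 ?expR_gt0 ?exprn_gt0.
rewrite mulrA ler_pdivrMr// mul1r; apply: le_trans.
by rewrite KE mulrDr expRD le_eqVlt; apply/orP; left; apply/eqP; ring.
Unshelve. all: by end_near.
Qed.

(** If [eps] were larger than [exp (beta * (K + eta))], both norms, cut after [N]
    terms, would be too small for their product to be 1. The condition [gap] makes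
    the tail of the series for the symbol 0 negligible against its first term. *)
Lemma rate_le_eps : rate_le eps K.
Proof.
move=> eta eta0; have e2 : 0 < eta / 2 by rewrite divr_gt0.
have [N1 hN1] : exists N, G false N <= b + K.
  have gap0 : 0 < b + K - L false by rewrite subr_gt0 gap.
  have [N hN] := G_lim false gap0; exists N; lra.
have [N2 hN2] := G_lim true e2.
pose N := maxn N1 N2.
have hG0 : G false (1 + N) <= b + K.
  by apply: le_trans hN1; apply: Gmono; rewrite /N; lia.
have hG1 : G true (1 + N) <= L true + eta / 2.
  by apply: le_trans hN2; apply: Gmono; rewrite /N; lia.
near=> beta.
have b0 : 0 < beta by near: beta; exact: near_pinfty_gt.
have /andP[x0 x1] := x01 b0.
have e0 : 0 < eps beta by rewrite subr_gt0.
rewrite leNgt; apply/negP => lt_eps.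
have ub s : run_norm G beta (x beta) s <=
    N%:R * expR (beta * G s 1) + expR (beta * (G s (1 + N)%N - K - eta)).
  apply: (le_trans (tail_sum_le_split 1 N (x01 b0) (u_geo s b0))).
  apply: lerD; first by rewrite ler_wpM2l//; exact: u_le.
  rewrite ler_pdivrMr//.
  apply: (le_trans (u_le s (1 + N) b0)).
  have -> : beta * G s (1 + N)%N =
      beta * (G s (1 + N)%N - K - eta) + beta * (K + eta) by ring.
  by rewrite expRD ler_pM2l ?expR_gt0// ltW.
have ub0 : run_norm G beta (x beta) false <= (N%:R + 1) * expR (beta * b).
  apply: (le_trans (ub false)); rewrite bE mulrDl mul1r lerD2l ler_expR ler_pM2l//.
  lra.
have ub1 : run_norm G beta (x beta) true <=
    N%:R * expR (beta * d) + expR (beta * (- b - eta / 2)).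
  apply: (le_trans (ub true)); rewrite dE lerD2l ler_expR ler_pM2l//.
  by rewrite KE; lra.
have : 1 <= ((N%:R + 1) * expR (beta * b)) *
    (N%:R * expR (beta * d) + expR (beta * (- b - eta / 2))).
  rewrite -[leLHS](x_norm b0).
  by apply: ler_pM => //; apply: ltW; apply: run_norm_gt0 => //; exact: x01.
have -> : ((N%:R + 1) * expR (beta * b)) *
    (N%:R * expR (beta * d) + expR (beta * (- b - eta / 2))) =
    (N%:R + 1) * N%:R * expR (beta * (b + d)) +
    (N%:R + 1) * expR (beta * (- (eta / 2))).
  have -> : beta * (- b - eta / 2) = - (beta * b) + beta * (- (eta / 2)) by ring.
  rewrite mulrDr !expRD expRN [beta * (b + _)]mulrDr expRD.
  by field; rewrite gt_eqF ?expR_gt0.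
rewrite leNgt => /negP; apply.
have small (c r : R) : 0 <= c -> 3 * c <= expR (beta * r) -> c * expR (beta * - r) <= 3^-1.
  move=> c0 h; rewrite mulrN expRN ler_pdivrMr ?expR_gt0//; lra.
have s1 : (N%:R + 1) * N%:R * expR (beta * (b + d)) <= 3^-1.
  rewrite -[b + _]opprK; apply: small; first by rewrite mulr_ge0.
  by near: beta; apply: le_expR_near; have := b_lt0; have := d_lt0; lra.
have s2 : (N%:R + 1) * expR (beta * (- (eta / 2))) <= 3^-1.
  apply: small; first by rewrite addr_ge0.
  by near: beta; exact: le_expR_near.
lra.
Unshelve. all: by end_near.
Qed.

Lemma has_rate_eps : has_rate eps K.
Proof. by split; [exact: rate_ge_eps|exact: rate_le_eps]. Qed.

(** The tail is governed either by its first term or by its far terms, which are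
    about [exp (beta * L s)] and of which about [1 / eps] count. *)
Lemma has_rate_tail s n :
  has_rate (fun beta => tail_sum (fun k => u s k beta) n) (Num.max (G s n) (L s - K)).
Proof.
split.
  apply: rate_ge_max.
    apply: rate_ge_mono (has_rate_u s n).1 _; near=> beta.
    have b0 : 0 < beta by near: beta; exact: near_pinfty_gt.
    have := tail_sum_ge n 1 (x01 b0) (u_geo s b0).
    by rewrite /tail_partial_sum big_ord1 addn0.
  have hr := has_rateM (has_rateM (has_rate_expR (L s)) (has_rate_xn n)) (has_rateV has_rate_eps).
  rewrite addr0 in hr; apply: rate_ge_mono hr.1 _; near=> beta.
  by apply: tail_u_ge; near: beta; exact: near_pinfty_gt.
apply: rate_le_limit => e e0; have [N hN] := G_lim s e0.
have hr := has_rateD (has_rateM (has_rate_cst (ltr0Sn R N)) (has_rate_u s n))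
  (has_rateM (has_rate_u s (n + N)) (has_rateV has_rate_eps)).
apply: rate_le_mono (rate_le_weaken _ hr.2) _.
  rewrite add0r ge_max; apply/andP; split.
    by rewrite (@le_trans _ _ (Num.max (G s n) (L s - K)))// ?le_max ?lexx// lerDl ltW.
  apply: (@le_trans _ _ (L s - K + e)); last by rewrite lerD2r le_max lexx orbT.
  by have := @Gmono s N (n + N) (leq_addl _ _); lra.
near=> beta.
have b0 : 0 < beta by near: beta; exact: near_pinfty_gt.
apply: (le_trans (tail_sum_le_split n N (x01 b0) (u_geo s b0))).
rewrite lerD2r ler_pM2r ?ler_nat//.
exact: (u_geo s b0 n).1.
Unshelve. all: by end_near.
Qed.

(** As for [has_rate_tail], the double sum having about [1 / eps ^ 2] far terms. *)
Lemma has_rate_tail_tail s n :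
  has_rate (fun beta => tail_sum (tail_sum (fun k => u s k beta)) n)
    (Num.max (G s n) (L s - K - K)).
Proof.
have t_geo beta : 0 < beta -> geometric_decay (x beta) (tail_sum (fun k => u s k beta)).
  by move=> b0; apply: tail_sum_geometric_decay; [exact: x01|exact: u_geo].
split.
  apply: rate_ge_max.
    apply: rate_ge_mono (has_rate_u s n).1 _; near=> beta.
    have b0 : 0 < beta by near: beta; exact: near_pinfty_gt.
    have := tail_sum_ge n 1 (x01 b0) (t_geo _ b0).
    rewrite /tail_partial_sum big_ord1 addn0; apply: le_trans.
    have := tail_sum_ge n 1 (x01 b0) (u_geo s b0).
    by rewrite /tail_partial_sum big_ord1 addn0.
  have hr := has_rateM (has_rateM (has_rateM (has_rate_expR (L s)) (has_rate_xn n))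
    (has_rateV has_rate_eps)) (has_rateV has_rate_eps).
  rewrite addr0 in hr; apply: rate_ge_mono hr.1 _; near=> beta.
  have b0 : 0 < beta by near: beta; exact: near_pinfty_gt.
  have /andP[x0 x1] := x01 b0.
  have c0 : 0 < expR (beta * L s) / eps beta by rewrite divr_gt0 ?expR_gt0 ?subr_gt0.
  rewrite [X in X / _ <= _](_ : _ = expR (beta * L s) / eps beta * x beta ^+ n); last by ring.
  rewrite -tail_sum_expr ?x01//; apply: tail_sum_mono.
  - exact: is_cvg_tail n (x01 b0) (geometric_decay_expr x0 c0).
  - exact: is_cvg_tail n (x01 b0) (t_geo _ b0).
  by move=> k _; rewrite mulrAC; exact: tail_u_ge.
apply: rate_le_limit => e e0; have [N hN] := G_lim s e0.
have hr := has_rateD (has_rateM (has_rate_cst (ltr0Sn R N)) (has_rate_tail s n))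
  (has_rateM (has_rateM (has_rate_u s (n + N)) (has_rateV has_rate_eps))
    (has_rateV has_rate_eps)).
apply: rate_le_mono (rate_le_weaken _ hr.2) _.
  have K0 := K_lt0.
  have := @Gmono s N (n + N) (leq_addl _ _).
  rewrite add0r !ge_max => h; apply/andP; split; [apply/andP; split|].
  - by rewrite (@le_trans _ _ (Num.max (G s n) (L s - K - K)))// ?le_max ?lexx// lerDl ltW.
  - apply: (@le_trans _ _ (L s - K - K + e)); first by lra.
    by rewrite lerD2r le_max lexx orbT.
  - apply: (@le_trans _ _ (L s - K - K + e)); first by lra.
    by rewrite lerD2r le_max lexx orbT.
near=> beta.
have b0 : 0 < beta by near: beta; exact: near_pinfty_gt.
have /andP[x0 x1] := x01 b0.
have tle n' N'' : tail_sum (fun k => u s k beta) (n' + N'') <= u s (n' + N'') beta / eps beta.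
  by apply: tail_sum_le => //; [exact: x01|exact: u_geo].
apply: (le_trans (tail_sum_le_split n N (x01 b0) (t_geo _ b0))).
apply: lerD; first by rewrite ler_pM2r ?ler_nat//; exact: (t_geo _ b0 n).1.
by rewrite ler_pM2r ?invr_gt0 ?subr_gt0.
Unshelve. all: by end_near.
Qed.

Definition law_rate s n := G s n + (if s then b else - b).
Definition survival_rate s n :=
  Num.max (G s n) (L s - K) + (if s then b else - b).
Definition survival_sum_rate s n :=
  Num.max (G s n) (L s - K - K) + (if s then b else - b).

Fixpoint renewal_rate (s : bool) (k : nat) (w : seq bool) : R :=
  if w is c :: w' then
    if c == s then renewal_rate s k.+1 w' else law_rate s k + renewal_rate c 1 w'
  else survival_rate s k.

Fixpoint stationary_rate (s : bool) (k : nat) (w : seq bool) : R :=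
  if w is c :: w' then
    if c == s then stationary_rate s k.+1 w' else survival_rate s k + renewal_rate c 1 w'
  else survival_sum_rate s k.

(** Minus the exponential rate of the mass of the cylinder of [w]; the summand
    [K] comes from the mean cycle length, whose rate is [- K]. *)
Definition cylinder_cost (w : seq bool) : R :=
  if w is s :: w' then - (stationary_rate s 1 w' + K) else 0.

Lemma has_rate_run_norm s :
  has_rate (fun beta => run_norm G beta (x beta) s) (if s then - b else b).
Proof.
have h0 : has_rate (fun beta => run_norm G beta (x beta) false) b.
  have := has_rate_tail false 1.
  by rewrite bE (max_idPl _)//; have := gap; lra.
case: s => //; apply: has_rate_near (has_rateV h0); near=> beta.
have b0 : 0 < beta by near: beta; exact: near_pinfty_gt.
have k0 := run_norm_gt0 G_dec false b0 (x01 b0).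
by rewrite -[RHS](mulKf (lt0r_neq0 k0)) x_norm// mulr1.
Unshelve. all: by end_near.
Qed.

Lemma has_rate_normV s :
  has_rate (fun beta => (run_norm G beta (x beta) s)^-1) (if s then b else - b).
Proof. by have := has_rateV (has_rate_run_norm s); case: s => //; rewrite opprK. Qed.

Lemma has_rate_run_law s n :
  has_rate (fun beta => run_law G beta (x beta) s n) (law_rate s n).
Proof. by rewrite /law_rate addrC; apply: has_rateM (has_rate_normV s) (has_rate_u s n). Qed.

Lemma has_rate_run_survival s n :
  has_rate (fun beta => run_survival G beta (x beta) s n) (survival_rate s n).
Proof.
rewrite /survival_rate addrC.
apply: has_rate_near (has_rateM (has_rate_normV s) (has_rate_tail s n)); near=> beta.
have b0 : 0 < beta by near: beta; exact: near_pinfty_gt.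
by rewrite run_survivalE//; exact: x01.
Unshelve. all: by end_near.
Qed.

Lemma has_rate_run_survival_sum s n :
  has_rate (fun beta => run_survival_sum G beta (x beta) s n) (survival_sum_rate s n).
Proof.
rewrite /survival_sum_rate addrC.
apply: has_rate_near (has_rateM (has_rate_normV s) (has_rate_tail_tail s n)); near=> beta.
have b0 : 0 < beta by near: beta; exact: near_pinfty_gt.
rewrite /run_survival_sum -tail_sumZ.
  by congr tail_sum; apply/funext => k; rewrite run_survivalE//; exact: x01.
exact: is_cvg_tail n (x01 b0) (tail_sum_geometric_decay (x01 b0) (u_geo s b0)).
Unshelve. all: by end_near.
Qed.

Lemma has_rate_renewal_weight s k w :
  has_rate (fun beta => renewal_weight (run_law G beta (x beta))
    (run_survival G beta (x beta)) s k w) (renewal_rate s k w).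
Proof.
elim: w s k => [|c w IH] s k /=; first exact: has_rate_run_survival.
case: ifP => _; first exact: IH.
by apply: has_rateM; [exact: has_rate_run_law|exact: IH].
Qed.

Lemma has_rate_stationary_weight s k w :
  has_rate (fun beta => stationary_weight (run_law G beta (x beta))
    (run_survival G beta (x beta)) (run_survival_sum G beta (x beta)) s k w)
  (stationary_rate s k w).
Proof.
elim: w s k => [|c w IH] s k /=; first exact: has_rate_run_survival_sum.
case: ifP => _; first exact: IH.
by apply: has_rateM; [exact: has_rate_run_survival|exact: has_rate_renewal_weight].
Qed.

Lemma survival_sum_rate_true n : survival_sum_rate true n = - K.
Proof.
have G1 : G true n <= 0 by rewrite -(G0 true); exact: Gmono.
have K0 := K_lt0.
have := KE; have := b_lt0 => h1 h2.
by rewrite /survival_sum_rate (max_idPr _); lra.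
Qed.

Lemma has_rate_mean_cycle :
  has_rate (fun beta => mean_cycle (run_survival_sum G beta (x beta))) (- K).
Proof.
have := has_rateD (has_rate_run_survival_sum false 1) (has_rate_run_survival_sum true 1).
rewrite survival_sum_rate_true (max_idPr _)// /survival_sum_rate bE.
have K0 := K_lt0; rewrite lerBlDr ge_max.
by have := b_lt0; have := gap => h1 h2; apply/andP; split; lra.
Qed.

Lemma has_rate_cylinder_mass w :
  has_rate (fun beta => run_cylinder_mass G beta (x beta) w) (- cylinder_cost w).
Proof.
case: w => [|s w]; first by rewrite /= oppr0; apply: has_rate_cst; exact: ltr01.
rewrite /= opprK.
have := has_rateM (has_rate_stationary_weight s 1 w) (has_rateV has_rate_mean_cycle).
by rewrite opprK.
Qed.

Lemma cylinder_cost_rcons w :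
  cylinder_cost w = Num.min (cylinder_cost (rcons w false)) (cylinder_cost (rcons w true)).
Proof.
apply: oppr_inj; rewrite oppr_min; apply: has_rate_unique (has_rate_cylinder_mass w) _.
apply: has_rate_near (has_rateD (has_rate_cylinder_mass _) (has_rate_cylinder_mass _)).
near=> beta; have b0 : 0 < beta by near: beta; exact: near_pinfty_gt.
by rewrite run_cylinder_mass_rcons//; exact: x01.
Unshelve. all: by end_near.
Qed.

Lemma cylinder_cost_cons_ge s w : cylinder_cost w <= cylinder_cost (s :: w).
Proof.
rewrite -lerN2.
apply: rate_ge_le (has_rate_cylinder_mass (s :: w)).1 (has_rate_cylinder_mass w).2 _.
near=> beta; have b0 : 0 < beta by near: beta; exact: near_pinfty_gt.
rewrite -(run_cylinder_mass_cons G_dec w b0 (x01 b0)).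
by case: s; rewrite ?lerDl ?lerDr; apply: ltW; apply: run_cylinder_mass_gt0 => //; exact: x01.
Unshelve. all: by end_near.
Qed.

Lemma renewal_rate_nseq s k n w :
  renewal_rate s k (nseq n s ++ w) = renewal_rate s (k + n) w.
Proof. by elim: n k => [|n IH] k /=; rewrite ?addn0// eqxx IH addSnnS. Qed.

Lemma stationary_rate_nseq s k n w :
  stationary_rate s k (nseq n s ++ w) = stationary_rate s (k + n) w.
Proof. by elim: n k => [|n IH] k /=; rewrite ?addn0// eqxx IH addSnnS. Qed.

Lemma survival_rate_true n : survival_rate true n = 0.
Proof.
have G1 : G true n <= 0 by rewrite -(G0 true); exact: Gmono.
have := KE; have := b_lt0 => h1 h2.
by rewrite /survival_rate (max_idPr _); lra.
Qed.

Lemma survival_rate1 s : survival_rate s 1 = 0.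
Proof.
case: s; first exact: survival_rate_true.
by rewrite /survival_rate bE (max_idPl _) ?subrr//; have := gap; lra.
Qed.

Lemma cylinder_cost_run s q w : (0 < q)%N ->
  cylinder_cost (nseq q s ++ ~~ s :: w) =
  - (survival_rate s q + renewal_rate (~~ s) 1 w + K).
Proof.
case: q => // q _ /=; rewrite stationary_rate_nseq add1n /=.
by case: s.
Qed.

Lemma cylinder_cost_switch_run s q w : (0 < q)%N ->
  cylinder_cost (~~ s :: nseq q s ++ ~~ s :: w) =
  - (law_rate s q + renewal_rate (~~ s) 1 w + K).
Proof.
case: q => // q _ /=; rewrite renewal_rate_nseq add1n /= survival_rate1 add0r.
by case: s.
Qed.

Lemma cylinder_cost_nseq s n :
  cylinder_cost (nseq n.+1 s) = - (survival_sum_rate s n.+1 + K).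
Proof. by rewrite /= -[nseq n s]cats0 stationary_rate_nseq add1n. Qed.

Lemma cylinder_cost_switch_nseq s n :
  cylinder_cost (~~ s :: nseq n.+1 s) = - (survival_rate s n.+1 + K).
Proof.
rewrite /= -[nseq n s]cats0 renewal_rate_nseq add1n survival_rate1 add0r.
by case: s.
Qed.

Lemma survival_sum_rate_false_eventually : exists N, forall n, (N <= n)%N ->
  survival_sum_rate false n = L false - K - K - b.
Proof.
have K0 := K_lt0; have e0 : 0 < - K - K by lra.
have [N hN] := G_lim false e0.
exists N => n Nn; rewrite /survival_sum_rate (max_idPr _)//.
have := @Gmono false N n Nn; lra.
Qed.

Lemma survival_rate_false_eventually : exists N, forall n, (N <= n)%N ->
  survival_rate false n = L false - K - b.
Proof.
have K0 := K_lt0; have e0 : 0 < - K by lra.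
have [N hN] := G_lim false e0.
exists N => n Nn; rewrite /survival_rate (max_idPr _)//.
have := @Gmono false N n Nn; lra.
Qed.

Section shift_cocycle.
Variables f U Rp : binseq -> R.
Hypothesis f_run : forall s n, (0 < n)%N ->
  forall y, cylinder (rcons (nseq n s) (~~ s)) y -> f y = G s n - G s n.-1.
Hypothesis f_const : forall s, f (fun=> s) = 0.
Hypothesis U_zeros : U zeros = 0.
Hypothesis U_ones : U ones = b.
Hypothesis U_run0 : forall q, (0 < q)%N ->
  forall y, cylinder (rcons (nseq q false) true) y ->
  U y = Num.max K (L false - G false q).
Hypothesis U_run1 : forall q, (0 < q)%N ->
  forall y, cylinder (rcons (nseq q true) false) y -> U y = K - G true q.
Hypothesis RpE : forall y, Rp y = - f y - U y + U (shift_map y).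

Lemma max_survival_rate q :
  Num.max K (L false - G false q) = survival_rate false q + b + K - G false q.
Proof.
rewrite /survival_rate /=.
have [h1|h1] := leP K (L false - G false q);
by have [h2|h2] := leP (G false q) (L false - K); lra.
Qed.

Lemma U_run s q y : (0 < q)%N -> cylinder (rcons (nseq q s) (~~ s)) y ->
  U y = survival_rate s q + (if s then 0 else b) + K - G s q.
Proof.
case: s => q0 yq; first by rewrite (U_run1 q0 yq) survival_rate_true; lra.
by rewrite (U_run0 q0 yq) max_survival_rate.
Qed.

(** The cocycle [Rp] is exactly the cost of adding one letter in front, once the
    word shows the end of its first run or, if that run is infinite, once its
    length is past the point where the rates become constant. *)
Lemma cylinder_cost_shift y : exists N, forall n, (N <= n)%N ->
  cylinder_cost (mkseq y n.+1) = Rp y + cylinder_cost (mkseq (shift_map y) n).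
Proof.
have [[s yE]|[s [q [q0 yq]]]] := binseq_run_cases (shift_map y); last first.
  exists q.+1 => n qn; rewrite mkseq_shift (mkseq_run yq qn) RpE (U_run q0 yq).
  have [y0|y0] : y 0%N = s \/ y 0%N = ~~ s by
  case: (y 0%N); case: (s); [left|right|right|left].
    have yq1 : cylinder (rcons (nseq q.+1 s) (~~ s)) y by exact: cylinder_cons.
    rewrite (f_run _ yq1)// (U_run _ yq1)// y0 -cat_cons -[s :: nseq q s]/(nseq q.+1 s).
    by rewrite !cylinder_cost_run//=; lra.
  have yq1 : cylinder (rcons (nseq 1 (~~ s)) (~~ ~~ s)) y.
    apply: cylinder_cons => // -[|//] _; rewrite yq ?size_rcons//.
    by case: (q) q0 => // q' _; rewrite /= negbK.
  rewrite (f_run _ yq1)// (U_run _ yq1)// y0 survival_rate1 G0.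
  rewrite cylinder_cost_switch_run// cylinder_cost_run//.
  by rewrite /law_rate; case: (s) => /=; rewrite ?survival_rate_true ?bE; lra.
have Uconst : U (shift_map y) = if s then b else 0 by rewrite yE; case: (s).
have [y0|y0] : y 0%N = s \/ y 0%N = ~~ s by
  case: (y 0%N); case: (s); [left|right|right|left].
  have yc : y = fun=> s.
    by apply/funext => -[//|i]; rewrite -[LHS]/(shift_map y i) yE.
  have [N hN] : exists N, forall n, (N <= n)%N ->
      survival_sum_rate s n = survival_sum_rate s n.+1.
    case: (s); first by exists 0%N => n _; rewrite !survival_sum_rate_true.
    have [N hN] := survival_sum_rate_false_eventually.
    by exists N => n Nn; rewrite !hN// leqW.
  exists N.+1 => -[//|n] Nn; rewrite RpE Uconst yE yc f_const !mkseq_const.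
  rewrite !cylinder_cost_nseq -(hN n.+1) 1?ltnW//.
  by case: (s); rewrite -/zeros -/ones ?U_zeros ?U_ones; lra.
have yq1 : cylinder (rcons (nseq 1 (~~ s)) (~~ ~~ s)) y.
  by apply: cylinder_cons => // -[|//] _; rewrite yE negbK.
rewrite RpE (f_run _ yq1)// (U_run _ yq1)// survival_rate1 G0 Uconst.
have [N hN] : exists N, forall n, (N <= n)%N ->
    survival_sum_rate s n = survival_rate s n - K.
  case: (s); first by exists 0%N => n _; rewrite survival_sum_rate_true survival_rate_true; lra.
  have [N hN] := survival_sum_rate_false_eventually.
  have [N' hN'] := survival_rate_false_eventually.
  exists (maxn N N') => n; rewrite geq_max => /andP[Nn Nn'].
  by rewrite hN// hN'//; lra.
exists N.+1 => -[//|n] Nn; rewrite mkseq_shift yE y0 mkseq_const.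
rewrite cylinder_cost_switch_nseq cylinder_cost_nseq hN 1?ltnW//.
by case: (s); rewrite /=; lra.
Qed.

End shift_cocycle.

End run_rates.

(** * The deviation function of a cost on words *)

Section deviation_function.
Context {R : realType}.
Variable J : seq bool -> R.
Hypothesis J_nil : J [::] = 0.
Hypothesis J_rcons : forall w, J w = Num.min (J (rcons w false)) (J (rcons w true)).

(** With this definition lower semicontinuity is automatic, and the value on
    cylinders follows from [J_rcons] alone. *)
Definition deviation_function (x : binseq) : \bar R :=
  ereal_sup (range (fun n => (J (mkseq x n))%:E)).

Lemma cost_le_rcons w c : J w <= J (rcons w c).
Proof. by rewrite [leLHS]J_rcons ge_min; case: c; rewrite lexx ?orbT. Qed.

Lemma cost_le_take n w : J (take n w) <= J w.
Proof.
elim/last_ind: w => [//|w c IH].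
have [nw|wn] := leqP n (size w).
  rewrite -cats1 takel_cat// cats1; apply: le_trans IH _; exact: cost_le_rcons.
by rewrite take_oversize// size_rcons.
Qed.

Lemma take_mkseq (x : binseq) m n : (m <= n)%N -> take m (mkseq x n) = mkseq x m.
Proof. by move=> mn; rewrite /mkseq -map_take take_iota (minn_idPl mn). Qed.

Lemma cost_mkseq_mono (x : binseq) m n : (m <= n)%N -> J (mkseq x m) <= J (mkseq x n).
Proof. by move=> mn; rewrite -(take_mkseq x mn); exact: cost_le_take. Qed.

Lemma deviation_function_ge x n : ((J (mkseq x n))%:E <= deviation_function x)%E.
Proof. by apply: ereal_sup_ubound; exists n. Qed.

Lemma deviation_function_ge0 x : (0 <= deviation_function x)%E.
Proof. by have := deviation_function_ge x 0; rewrite J_nil. Qed.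

Lemma lower_semicontinuous_deviation_function :
  lower_semicontinuous (deviation_function : binseq -> \bar R).
Proof.
move=> x a /ereal_sup_gt[_ [n _ <-] aJ].
exists (cylinder (mkseq x n)); first by apply/nbhs_cylinder; exists n.
move=> y /cylinderP; rewrite size_mkseq => xy.
by apply: lt_le_trans (deviation_function_ge y n); rewrite xy.
Qed.

(** Following at each step an extension of least cost keeps the cost equal to
    [J w], so the infimum over the cylinder is attained. *)
Lemma ereal_inf_deviation_function w :
  ereal_inf [set deviation_function x | x in cylinder w] = (J w)%:E.
Proof.
apply/le_anti/andP; split; last first.
  apply: le_ereal_inf_tmp => _ [x /cylinderP wx <-].
  by have := deviation_function_ge x (size w); rewrite wx.
have step v : exists c, J (rcons v c) = J v.
  by rewrite [J v]J_rcons; case: leP => _; [exists false|exists true].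
have [ext Jext] := choice step.
pose W n := iter n (fun v => rcons v (ext v)) w.
have sizeW n : size (W n) = (size w + n)%N.
  by elim: n => [|n IH] /=; rewrite ?addn0// size_rcons IH addnS.
have JW n : J (W n) = J w by elim: n => [//|n IH] /=; rewrite Jext.
have WD n k i : (i < size (W n))%N -> nth false (W (n + k)%N) i = nth false (W n) i.
  move=> ni; elim: k => [|k IH]; first by rewrite addn0.
  rewrite addnS (_ : W _ = rcons (W (n + k)%N) (ext (W (n + k)%N)))//.
  by rewrite nth_rcons sizeW ifT//; move: ni; rewrite sizeW; lia.
(* [W i.+1] is long enough to have an [i]-th letter even if [w] is empty *)
pose x : binseq := fun i => nth false (W i.+1) i.
have xW n : cylinder (W n) x.
  move=> i ni; rewrite /x -(WD i.+1 n) ?sizeW; last by lia.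
  by rewrite addnC WD.
apply: ge_ereal_inf; exists (deviation_function x); first by exists x; [exact: (xW 0%N)|].
apply: ge_ereal_sup => _ [n _ <-]; rewrite lee_fin -(JW n).
have /cylinderP <- := xW n; apply: cost_mkseq_mono.
by rewrite sizeW leq_addl.
Qed.

Lemma deviation_function_eventually_const x r :
  (exists N, forall n, (N <= n)%N -> J (mkseq x n) = r) ->
  deviation_function x = r%:E.
Proof.
move=> [N hN]; apply/le_anti/andP; split; last first.
  by rewrite -(hN N)//; exact: deviation_function_ge.
apply: ge_ereal_sup => _ [n _ <-]; rewrite lee_fin -(hN (maxn n N)) ?leq_maxr//.
by apply: cost_mkseq_mono; rewrite leq_maxl.
Qed.

Lemma deviation_function_shift x y r :
  (exists N, forall n, (N <= n)%N -> J (mkseq x n.+1) = r + J (mkseq y n)) ->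
  deviation_function x = (r%:E + deviation_function y)%E.
Proof.
move=> [N hN]; apply/le_anti/andP; split.
  apply: ge_ereal_sup => _ [n _ <-].
  apply: (@le_trans _ _ (J (mkseq x (maxn n N).+1))%:E).
    rewrite lee_fin; apply: cost_mkseq_mono.
    by apply: leq_trans (leqnSn _); rewrite leq_maxl.
  rewrite hN ?leq_maxr// EFinD leeD2lE//; exact: deviation_function_ge.
rewrite -leeBrDl//; apply: ge_ereal_sup => _ [n _ <-].
rewrite leeBrDl//.
apply: le_trans (deviation_function_ge x (maxn n N).+1).
rewrite hN ?leq_maxr// EFinD leeD2lE// lee_fin; apply: cost_mkseq_mono.
by rewrite leq_maxl.
Qed.

Lemma large_deviation_principle_of_rates (mu : R -> probability binseq R)
    (mass : R -> seq bool -> R) :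
  (forall beta, 0 < beta -> forall w, mu beta (cylinder w) = (mass beta w)%:E) ->
  (forall beta, 0 < beta -> forall w, 0 < mass beta w) ->
  (forall w, has_rate (fun beta => mass beta w) (- J w)) ->
  large_deviation_principle mu deviation_function.
Proof.
move=> muE mass0 hr; split.
- exact: deviation_function_ge0.
- exact: lower_semicontinuous_deviation_function.
move=> w; rewrite ereal_inf_deviation_function.
have near_eq : {near +oo, (fun beta => (beta^-1 * ln (mass beta w))%:E) =1
    (fun beta => (beta^-1)%:E * lne (mu beta (cylinder w)))%E}.
  near=> beta; have b0 : 0 < beta by near: beta; exact: near_pinfty_gt.
  by rewrite muE// lne_EFin ?EFinM//; exact: mass0.
apply: cvg_trans; first exact: near_eq_cvg near_eq.
by apply: cvg_EFin; [near=> beta|exact: has_rate_cvg].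
Unshelve. all: by end_near.
Qed.

End deviation_function.

(** * Sums along the first run *)

Section first_run_sums.
Context {R : realType}.
Variables (theta : R) (f : binseq -> R).
Hypothesis theta01 : 0 < theta < 1.
Hypothesis lipf : dtheta_lipschitz theta f.
Variables (s : bool) (g : nat -> R).
Hypothesis fconst : f (fun=> s) = 0.
Hypothesis f_run : forall n, (0 < n)%N ->
  forall x, cylinder (rcons (nseq n s) (~~ s)) x -> f x = g n.
Hypothesis g_lt0 : forall n, (0 < n)%N -> g n < 0.

Definition run_sum n := \sum_(1 <= j < n.+1) g j.

Lemma run_sum0 : run_sum 0 = 0. Proof. by rewrite /run_sum big_geq. Qed.

Lemma run_sumS n : run_sum n.+1 = run_sum n + g n.+1.
Proof. by rewrite /run_sum big_nat_recr. Qed.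

Lemma run_sum_dec n : run_sum n.+1 <= run_sum n.
Proof. by rewrite run_sumS gerDl ltW// g_lt0. Qed.

Lemma run_sum_nonincreasing : nonincreasing_seq run_sum.
Proof. by apply/nonincreasing_seqP => n; exact: run_sum_dec. Qed.

(** A point with exactly [n] symbols [s] in front is at distance less than
    [theta ^ n] from the fixed point [s s s ...], where [f] vanishes. *)
Lemma run_sum_bounded : exists D, forall n, - D <= run_sum n.
Proof.
have [K hK] := lipf; have /andP[t0 t1] := theta01.
have K0 : 0 < `|K| + 1 by rewrite ltr_wpDl.
have g_ge n : (0 < n)%N -> - ((`|K| + 1) * theta ^+ n) <= g n.
  move=> n0; pose x := prepend (rcons (nseq n s) (~~ s)) zeros.
  have xn : cylinder (rcons (nseq n s) (~~ s)) x.
    by move=> i ni; rewrite /x /prepend ni.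
  have dx : dtheta theta x (fun=> s) < theta ^+ n.
    apply/dtheta_lt => // i ni; rewrite xn ?size_rcons ?size_nseq 1?ltnW//.
    by rewrite nth_rcons size_nseq ni nth_nseq ni.
  have d0 : 0 <= dtheta theta x (fun=> s).
    by rewrite /dtheta; case: pselect => // h; rewrite exprn_ge0// ltW.
  have := hK x (fun=> s); rewrite fconst subr0 (f_run n0 xn) ler_norml => /andP[h _].
  apply: le_trans h; rewrite lerN2.
  apply: (@le_trans _ _ ((`|K| + 1) * dtheta theta x (fun=> s))).
    by rewrite ler_wpM2r// ler_wpDr// ler_norm.
  by rewrite ler_pM2l// ltW.
exists ((`|K| + 1) / (1 - theta)) => n.
have part : (`|K| + 1) * (theta ^+ n.+1 / (1 - theta)) -
    (`|K| + 1) / (1 - theta) <= run_sum n.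
  elim: n => [|n IH].
    rewrite run_sum0 expr1 mulrA -mulrBl pmulr_lle0 ?invr_gt0 ?subr_gt0//.
    by rewrite subr_le0 ler_piMr//; exact: ltW.
  rewrite run_sumS; have := g_ge n.+1 isT.
  have e : (`|K| + 1) * (theta ^+ n.+1 / (1 - theta)) =
      (`|K| + 1) * theta ^+ n.+1 + (`|K| + 1) * (theta ^+ n.+2 / (1 - theta)).
    by rewrite [theta ^+ n.+2]exprS; field; rewrite subr_eq0 gt_eqF.
  by rewrite e in IH; lra.
apply: le_trans part; rewrite lerBrDr addrC subrr mulr_ge0 ?ltW// divr_gt0 ?exprn_gt0//.
by rewrite subr_gt0.
Qed.

Definition run_total : R := limn run_sum.

Lemma is_cvg_run_sum : cvgn run_sum.
Proof.
have [D hD] := run_sum_bounded.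
apply: nonincreasing_is_cvgn; first exact: run_sum_nonincreasing.
by exists (- D) => _ [n _ <-].
Qed.

Lemma run_total_le n : run_total <= run_sum n.
Proof. by apply: nonincreasing_cvgn_ge; [exact: run_sum_nonincreasing|exact: is_cvg_run_sum]. Qed.

Lemma run_total_approx e : 0 < e -> exists N, run_sum N <= run_total + e.
Proof.
move=> e0; have /cvgrPdist_le /(_ _ e0) [N _ /(_ N (leqnn N))] := is_cvg_run_sum.
rewrite /= distrC => /(le_trans (ler_norm _)); rewrite lerBlDl => h.
by exists N.
Qed.

Lemma run_total_tail (a : nat -> R) q : (0 < q)%N ->
  (forall n, (2 <= n)%N -> a n = g n) ->
  \sum_(1 <= j <oo) a (q + j)%N = run_total - run_sum q.
Proof.
move=> q0 ag; apply/cvg_lim => //; rewrite -cvg_shiftS.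
have -> : (fun n => \sum_(1 <= j < n.+1) a (q + j)%N) =
    (fun n => run_sum (n + q)%N - run_sum q).
  apply/funext => n; elim: n => [|n IH]; first by rewrite big_geq// subrr.
  rewrite big_nat_recr//= IH addSn run_sumS ag; last by lia.
  by rewrite addnS [(q + n)%N]addnC; ring.
apply: cvgB; last exact: cvg_cst.
by rewrite (cvg_shiftn q run_sum); exact: is_cvg_run_sum.
Qed.

Lemma run_total_from2 (a : nat -> R) :
  (forall n, (2 <= n)%N -> a n = g n) ->
  \sum_(2 <= j <oo) a j = run_total - g 1.
Proof.
move=> ag; apply/cvg_lim => //; rewrite -cvg_shiftS.
have -> : (fun n => \sum_(2 <= j < n.+1) a j) =
    (fun n => run_sum n - (if n is 0%N then 0 else g 1)).
  apply/funext => -[|n]; first by rewrite big_geq// run_sum0 subrr.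
  elim: n => [|n IH]; first by rewrite big_geq// run_sumS run_sum0 add0r subrr.
  by rewrite big_nat_recr//= IH [run_sum n.+2]run_sumS ag//; ring.
apply: cvgB; first exact: is_cvg_run_sum.
by rewrite -cvg_shiftS; exact: cvg_cst.
Qed.

End first_run_sums.

(** * The large deviation principle *)

Lemma prepend_nil (y : binseq) : prepend [::] y = y.
Proof. by apply/funext => i; rewrite /prepend /= subn0. Qed.

Lemma shift_prepend_cons c w (y : binseq) : shift_map (prepend (c :: w) y) = prepend w y.
Proof. by apply/funext => i; rewrite /shift_map /prepend /= ltnS subSS. Qed.

Section cocycle_deviation.
Context {R : realType}.
Variables (J : seq bool -> R) (Rp : binseq -> R).
Hypothesis J_nil : J [::] = 0.
Hypothesis J_rcons : forall w, J w = Num.min (J (rcons w false)) (J (rcons w true)).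
Hypothesis J_shift : forall y, exists N, forall n, (N <= n)%N ->
  J (mkseq y n.+1) = Rp y + J (mkseq (shift_map y) n).

Let I := deviation_function J.

Lemma deviation_function_cocycle y : I y = ((Rp y)%:E + I (shift_map y))%E.
Proof. exact: deviation_function_shift (J_shift y). Qed.

Lemma deviation_function_prepend w y :
  I (prepend w y) = ((birkhoff_sum Rp (size w) (prepend w y))%:E + I y)%E.
Proof.
elim: w => [|c w IH].
  by rewrite prepend_nil /birkhoff_sum big_ord0 add0e.
by rewrite deviation_function_cocycle /= birkhoff_sumS shift_prepend_cons EFinD -addeA -IH.
Qed.

Hypothesis J_cons : forall s w, J w <= J (s :: w).

Lemma deviation_cocycle_ge0 y : 0 <= Rp y.
Proof.
have [N /(_ N (leqnn N))] := J_shift y; rewrite mkseq_shift => h.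
by have := J_cons (y 0%N) (mkseq (shift_map y) N); rewrite h lerDr.
Qed.

Lemma deviation_function_shift_le n y : (I (iter n shift_map y) <= I y)%E.
Proof.
elim: n => [//|n IH]; apply: le_trans IH.
by rewrite [leRHS]deviation_function_cocycle leeDr// lee_fin deviation_cocycle_ge0.
Qed.

Variable delta : R.
Hypothesis delta_gt0 : 0 < delta.
Hypothesis Rp_switch : forall q, (0 < q)%N -> forall y, y 0%N = false ->
  cylinder (rcons (nseq q true) false) (shift_map y) -> delta <= Rp y.

(** A point that is not eventually constant switches infinitely often from 0 to
    1, and each switch costs at least [delta]. *)
Lemma deviation_function_pinfty y :
  (forall w, y <> prepend w zeros) -> (forall w, y <> prepend w ones) -> I y = +oo%E.
Proof.
move=> y0 y1.
pose recurrent (y : binseq) := forall n s, exists2 i, (n <= i)%N & y i = s.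
have yrec : recurrent y.
  move=> n s; apply: contrapT => h.
  have ys i : (n <= i)%N -> y i = ~~ s.
    move=> ni; have : y i <> s by move=> ?; apply: h; exists i.
    by case: (y i) (s) => -[].
  have ye : y = prepend (mkseq y n) (fun=> ~~ s).
    apply/funext => i; rewrite /prepend size_mkseq; case: ltnP => ni; last exact: ys.
    by rewrite nth_mkseq.
  by case: s {h ys} ye => ye; [exact: (y0 _ ye)|exact: (y1 _ ye)].
have recS n z : recurrent z -> recurrent (iter n shift_map z).
  move=> zrec k s; have [i ki zi] := zrec (n + k)%N s.
  exists (i - n)%N; first by lia.
  by rewrite iter_shiftE subnKC//; lia.
have key N z : recurrent z -> ((N%:R * delta)%:E <= I z)%E.
  elim: N z => [|N IH] z zrec; first by rewrite mul0r; exact: deviation_function_ge0.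
  have [i0 _ zi0] := zrec 0%N false.
  have ex : exists j, z (i0 + j)%N.
    by have [j ij zj] := zrec i0 true; exists (j - i0)%N; rewrite subnKC// zj.
  have [j zj jmin] := ex_minnP ex.
  have j0 : (0 < j)%N by case: j zj {jmin} => //; rewrite addn0 zi0.
  pose z' := iter (i0 + j.-1) shift_map z.
  have z'0 : z' 0%N = false.
    rewrite /z' iter_shiftE addn0; apply/negbTE/negP => /jmin.
    by rewrite leqNgt prednK// leqnn.
  have z'1 : shift_map z' 0%N = true.
    by rewrite /shift_map /z' iter_shiftE -addnA addn1 prednK.
  have [q [q0 hq]] : exists q, (0 < q)%N /\ cylinder (rcons (nseq q true) false) (shift_map z').
    have [[s sE]|[s [q [q0 hq]]]] := binseq_run_cases (shift_map z').
      have [i _] := recS (i0 + j.-1).+1 z zrec 0%N (~~ s).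
      by rewrite iterS -/z' sE; case: (s).
    exists q; split => //; have : s = true.
      by rewrite -z'1 hq ?size_rcons//; case: (q) q0.
    by move=> se; rewrite se in hq.
  apply: le_trans (deviation_function_shift_le (i0 + j.-1) z).
  rewrite -/z' deviation_function_cocycle -natr1 mulrDl mul1r addrC EFinD.
  apply: leeD; first by rewrite lee_fin; exact: (Rp_switch q0).
  by apply: IH; rewrite /z' -iterS; exact: recS.
apply/eqyP => A A0; have [N AN] : exists N : nat, A <= N%:R * delta.
  exists (Num.bound (A / delta)); rewrite -ler_pdivrMr//.
  by apply/ltW; apply: archi_boundP; rewrite divr_ge0 ?ltW//.
by apply: le_trans (key N y yrec); rewrite lee_fin.
Qed.

End cocycle_deviation.

Unset Implicit Arguments.

Theorem theorem10 (R : realType) (theta : R) (htheta : 0 < theta < 1)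
  (f : binseq -> R) (hf : dtheta_lipschitz theta f)
  (b d : R) (a c : nat -> R)
  (hb : b < 0) (hd : d < 0)
  (ha : forall n : nat, (2 <= n)%N -> a n < 0)
  (hc : forall n : nat, (2 <= n)%N -> c n < 0)
  (f01 : forall x, cylinder [:: false; true] x -> f x = b)
  (f10 : forall x, cylinder [:: true; false] x -> f x = d)
  (fzeros : f zeros = 0) (fones : f ones = 0)
  (f0n1 : forall n : nat, (2 <= n)%N ->
    forall x, cylinder (rcons (nseq n false) true) x -> f x = a n)
  (f1n0 : forall n : nat, (2 <= n)%N ->
    forall x, cylinder (rcons (nseq n true) false) x -> f x = c n)
  (mu : R -> probability binseq R)
  (hmu : forall beta : R, 0 < beta ->
    is_equilibrium_measure (fun x => beta * f x) (mu beta))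
  (hac : \sum_(2 <= j <oo) a j < b + d + \sum_(2 <= j <oo) c j)
  (U : binseq -> R)
  (Uzeros : U zeros = 0)
  (U0q1 : forall q : nat, (1 <= q)%N ->
    forall x, cylinder (rcons (nseq q false) true) x ->
      U x = Num.max (b + d + \sum_(2 <= j <oo) c j)
                    (\sum_(1 <= j <oo) a (q + j)%N))
  (Uones : U ones = b)
  (U1q0 : forall q : nat, (1 <= q)%N ->
    forall x, cylinder (rcons (nseq q true) false) x ->
      U x = b + \sum_(1 <= j <oo) c (q + j)%N)
  (Rp : binseq -> R)
  (hRp : forall x, Rp x = - f x - U x + U (shift_map x)) :
  exists I : binseq -> \bar R,
    [/\ I zeros = (b + d + \sum_(2 <= j <oo) c j - \sum_(2 <= j <oo) a j)%:E,
        I ones = 0%:E,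
        forall w : seq bool, I (prepend w zeros) =
          ((birkhoff_sum Rp (size w) (prepend w zeros))%:E + I zeros)%E,
        forall w : seq bool, I (prepend w ones) =
          (birkhoff_sum Rp (size w) (prepend w ones))%:E &
        forall x, (forall w, x <> prepend w zeros) ->
          (forall w, x <> prepend w ones) -> I x = +oo%E]
    /\ large_deviation_principle mu I.
Proof.
pose g (s : bool) n := if n == 1%N then (if s then d else b) else if s then c n else a n.
pose G s : nat -> R := run_sum (g s); pose L s : R := run_total (g s).
pose K := b + L true; have KL : K = b + L true by [].
have frun s n : (0 < n)%N -> forall x, cylinder (rcons (nseq n s) (~~ s)) x -> f x = g s n.
  case: n => [//|[|n]] _ x; first by case: s => [/f10|/f01].
  by case: s => [/f1n0|/f0n1]; apply.
have fconst s : f (fun=> s) = 0 by case: s.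
have glt0 s n : (0 < n)%N -> g s n < 0.
  by case: n => [//|[|n]] _; case: s => //; rewrite /g /=; [exact: hc|exact: ha].
have Gdec s n : G s n.+1 <= G s n by exact: run_sum_dec (glt0 s) n.
have G0 s : G s 0%N = 0 by exact: run_sum0.
have Gge s n : L s <= G s n.
  exact: (run_total_le htheta hf (g := g s) (fconst s) (frun s) (glt0 s) n).
have Glim s e : 0 < e -> exists N, G s N <= L s + e.
  exact: (run_total_approx htheta hf (g := g s) (fconst s) (frun s) (glt0 s)).
have [D hD] : exists D, forall s n, - D <= G s n.
  by exists (- Num.min (L false) (L true)) => s n; rewrite opprK ge_min; case: s;
    rewrite Gge ?orbT.
have sumA : \sum_(2 <= j <oo) a j = L false - b.
  by apply: (run_total_from2 htheta hf (g := g false)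
    (fconst false) (frun false) (glt0 false)) => -[|[]].
have sumC : \sum_(2 <= j <oo) c j = L true - d.
  by apply: (run_total_from2 htheta hf (g := g true)
    (fconst true) (frun true) (glt0 true)) => -[|[]].
have tailA q : (1 <= q)%N -> \sum_(1 <= j <oo) a (q + j)%N = L false - G false q.
  move=> q1; apply: (run_total_tail htheta hf (g := g false)
    (fconst false) (frun false) (glt0 false)) => //.
  by case=> [|[]].
have tailC q : (1 <= q)%N -> \sum_(1 <= j <oo) c (q + j)%N = L true - G true q.
  move=> q1; apply: (run_total_tail htheta hf (g := g true)
    (fconst true) (frun true) (glt0 true)) => //.
  by case=> [|[]].
have KE : b + d + \sum_(2 <= j <oo) c j = K by rewrite sumC /K; ring.
have gap : L false < b + K by move: hac; rewrite KE sumA; lra.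
have bE : G false 1%N = b by rewrite /G run_sumS run_sum0 add0r.
have dE : G true 1%N = d by rewrite /G run_sumS run_sum0 add0r.
have mf := measurable_lipschitz htheta hf.
have hx beta : exists x, 0 < beta -> [/\ 0 < x < 1,
    run_norm G beta x false * run_norm G beta x true = 1 &
    forall w, mu beta (cylinder w) = (run_cylinder_mass G beta x w)%:E].
  have [b0|b0] := ltP 0 beta; last by exists 0.
  have [x hx] := equilibrium_run_cylinder_mass Gdec G0 (fun s n => erefl)
    (fun s n n0 => ltW (glt0 s n n0)) hD frun fconst mf b0 (hmu beta b0).
  by exists x.
have [x xP] := choice hx.
have x01 beta : 0 < beta -> 0 < x beta < 1 by move=> /xP[].
have x_norm beta : 0 < beta ->
  run_norm G beta (x beta) false * run_norm G beta (x beta) true = 1 by move=> /xP[].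
pose J := cylinder_cost G L b K.
have J_rcons := cylinder_cost_rcons Gdec G0 Gge Glim bE dE KL hb hd gap x01 x_norm.
have J_cons := cylinder_cost_cons_ge Gdec G0 Gge Glim bE dE KL hb hd gap x01 x_norm.
have J_rate := has_rate_cylinder_mass Gdec G0 Gge Glim bE dE KL hb hd gap x01 x_norm.
have J_shift : forall y, exists N, forall n, (N <= n)%N ->
    J (mkseq y n.+1) = Rp y + J (mkseq (shift_map y) n).
  apply: (cylinder_cost_shift Gdec G0 Gge Glim bE dE KL hb hd gap (f := f) (U := U)) => //.
  - by move=> s [//|n] _ y /(frun s n.+1 isT) ->; rewrite /G run_sumS; ring.
  - by move=> q q0 y /(U0q1 q q0) ->; rewrite KE tailA.
  - by move=> q q0 y /(U1q0 q q0) ->; rewrite tailC// /K; ring.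
have Rp_switch q : (0 < q)%N -> forall y, y 0%N = false ->
    cylinder (rcons (nseq q true) false) (shift_map y) -> - b <= Rp y.
  move=> q0 y y0 yq; have y01 : cylinder [:: false; true] y.
    apply: cylinder_cons => // -[|//] _.
    by rewrite yq ?size_rcons//; case: (q) q0.
  rewrite hRp (f01 _ y01) (U1q0 q q0 _ yq) (U0q1 1%N isT _ y01) KE !tailA// !tailC// bE.
  rewrite (max_idPl _); last by move: gap; lra.
  have : G true q <= 0 by elim: (q) => [|n IH]; rewrite ?G0// (le_trans (Gdec _ _)).
  by rewrite /K; lra.
have J_nil : J [::] = 0 by [].
have Izeros : deviation_function J zeros =
    (b + d + \sum_(2 <= j <oo) c j - \sum_(2 <= j <oo) a j)%:E.
  apply: (deviation_function_eventually_const J_rcons).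
  have [N hN] := survival_sum_rate_false_eventually Gdec Gge Glim dE KL hb hd.
  exists N.+1 => -[//|n] Nn; rewrite mkseq_const /J cylinder_cost_nseq hN 1?ltnW//.
  by rewrite KE sumA; ring.
have Iones : deviation_function J ones = 0%:E.
  apply: (deviation_function_eventually_const J_rcons); exists 1%N => -[//|n] _.
  rewrite mkseq_const /J cylinder_cost_nseq.
  by rewrite (survival_sum_rate_true Gdec G0 Gge dE KL hb hd) addNr oppr0.
exists (deviation_function J); split.
  split => //.
  - by move=> w; exact: (deviation_function_prepend J_rcons J_shift).
  - by move=> w; rewrite (deviation_function_prepend J_rcons J_shift) Iones adde0.
  - move=> y; apply: (deviation_function_pinfty J_nil J_rcons J_shift J_cons
      (_ : 0 < - b) Rp_switch).
    by rewrite oppr_gt0.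
apply: (large_deviation_principle_of_rates J_nil J_rcons
  (mass := fun beta w => run_cylinder_mass G beta (x beta) w)) => //.
- by move=> beta /xP[].
- by move=> beta b0 w; apply: run_cylinder_mass_gt0 => //; exact: x01.
Qed.
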